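(* Let $(\xi_j : j\in\mathbb{Z})$ be an i.i.d. sequence of positive random variables, and let $N_0=(N_0(t):t\ge 0)$ be the scheduled traffic counting process $$N_0(t)=\sum_{j\in\mathbb{Z}} I\big(j+\xi_j\in(0,t]\big),\qquad t\ge 0.$$ For $n\ge 2$ and $t\ge 0$ put $$X'_n(t)=\frac{N_0(nt)-\lfloor nt\rfloor}{\sqrt{\log n}}.$$ Suppose that, for some constant $d>0$, $$\mathbb{P}(\xi_0>x)\sim \frac{d}{x}\quad\text{as } x\to\infty.$$ Let $Z=(Z(t):t\ge 0)$ be a mean zero Gaussian process with $Z(0)=0$, $\mathrm{Var}\,Z(t)=2$ for $t>0$, and $\mathrm{Cov}(Z(s),Z(t))=1$ for $s,t>0$ with $s\ne t$. Then the finite-dimensional distributions of $X'_n$ converge weakly to those of $\sqrt{d}\,Z$ as $n\to\infty$; that is, for every $m\ge 1$ and all $t_1,\dots,t_m\ge 0$, the random vector $(X'_n(t_1),\dots,X'_n(t_m))$ converges in distribution to $\sqrt{d}\,(Z(t_1),\dots,Z(t_m))$.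
   Context: $I(\cdot)$ denotes the indicator of an event, and $\lfloor x\rfloor$ is the greatest integer less than or equal to $x$. The notation $f(x)\sim g(x)$ as $x\to\infty$ means $f(x)/g(x)\to 1$. In the model, customer $j$ is scheduled to arrive at time $jh$ and actually arrives at time $jh+\xi_j$; here $h=1$. *)

(* Defs.v *)
From HB Require Import structures.
From mathcomp Require Export all_boot all_order all_algebra.
From mathcomp Require Export all_classical all_reals all_analysis.
From mathcomp Require Export measurable_realfun.

Set Implicit Arguments.
Unset Strict Implicit.
Unset Printing Implicit Defensive.

Import Order.TTheory GRing.Theory Num.Theory.
Import numFieldNormedType.Exports.

Local Open Scope classical_set_scope.
Local Open Scope ring_scope.

Section sequences_of_random_variables.
Context (disp : measure_display) (T : measurableType disp) (R : realType).
Context (P : probability T R) (I : eqType).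

Definition independent_family (X : I -> {RV P >-> R}) : Prop :=
  forall (J : seq I) (A : I -> set R), uniq J ->
    (forall j, measurable (A j)) ->
    (P (\bigcap_(j in [set` J]) (X j @^-1` A j)) =
     \prod_(j <- J) P (X j @^-1` A j))%E.

Definition identically_distributed (X : I -> {RV P >-> R}) : Prop :=
  forall (i j : I) (A : set R), measurable A ->
    distribution P (X i) A = distribution P (X j) A.

Definition iid (X : I -> {RV P >-> R}) : Prop :=
  independent_family X /\ identically_distributed X.

End sequences_of_random_variables.

(* Gaussian law with mean a and standard deviation s, degenerate case included:
   [normal_prob a 0] is not the point mass at a in the library. *)
Definition gaussian_law (R : realType) (a s : R) (A : set R) : \bar R :=
  if s == 0 then \d_a A else normal_prob a s A.

Definition gaussian_process (disp : measure_display) (T : measurableType disp)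
    (R : realType) (P : probability T R) (I : Type)
    (Z : I -> {RV P >-> R}) : Prop :=
  forall (k : nat) (a : 'I_k -> R) (t : 'I_k -> I),
    exists mu sigma : R, 0 <= sigma /\
      forall A : set R, measurable A ->
        P ((fun w => \sum_(i < k) a i * Z (t i) w) @^-1` A) =
        gaussian_law mu sigma A.

(* Weak convergence of the laws of random vectors given by their coordinates;
   the limit may live on another probability space. *)
Definition cvg_in_distribution (R : realType)
    (disp : measure_display) (T : measurableType disp) (P : probability T R)
    (disp' : measure_display) (T' : measurableType disp')
    (P' : probability T' R) (m : nat)
    (X : nat -> 'I_m -> {RV P >-> R}) (Y : 'I_m -> {RV P' >-> R}) : Prop :=
  forall f : 'rV[R]_m -> R, continuous f -> bounded_fun f ->
    ('E_P[fun w => f (\row_i X n i w)] @[n --> \oo] -->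
     'E_P'[fun w => f (\row_i Y i w)])%E.

Section scheduled_traffic.
Context (disp : measure_display) (T : measurableType disp) (R : realType).
Context (P : probability T R) (xi : int -> {RV P >-> R}).

Definition traffic_count (t : R) (w : T) : \bar R :=
  (\esum_(j in [set: int]) (\1_(`]0%R, t]%classic) (j%:~R + xi j w))%:E)%E.

(* X'_n(t). For i.i.d. positive xi_j the count over ]0, t] is almost surely
   finite (E[count] <= t + 1), so that [fine] only alters a null event. *)
Definition centered_traffic (n : nat) (t : R) (w : T) : R :=
  (fine (traffic_count (n%:R * t) w) - (Num.floor (n%:R * t))%:~R)
    / Num.sqrt (ln n%:R).

Lemma measurable_centered_traffic (n : nat) (t : R) :
  measurable_fun [set: T] (centered_traffic n t).
Proof.
pose e (k : nat) : int := if odd k then Negz k./2 else Posz k./2.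
have be : set_bij [set: nat] [set: int] e.
  split=> // [k l _ _ | [] k _].
  - rewrite /e; have := odd_double_half k; have := odd_double_half l.
    by case: (odd k); case: (odd l) => //= hl hk -[E]; rewrite -hl -hk E.
  - by exists k.*2 => //; rewrite /e odd_double doubleK.
  - exists k.*2.+1 => //; rewrite /e /= odd_double /=.
    by rewrite uphalf_double.
have mN s : measurable_fun [set: T] (traffic_count s : T -> \bar R).
  rewrite (_ : traffic_count s = fun w =>
    (\sum_(k <oo) (\1_(`]0%R, s]%classic) ((e k)%:~R + xi (e k) w))%:E)%E).
    apply: ge0_emeasurable_sum => [k w _ _|k _].
      by rewrite lee_fin.
    apply/measurable_EFinP.
    apply: (measurableT_comp (measurable_indic _)) => //.
    exact: measurable_funD.
  apply/funext => w; rewrite /traffic_count (reindex_esum setT _ e)//.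
  by rewrite nneseries_esumT// => k; rewrite lee_fin.
apply: measurable_funM => //; apply: measurable_funB => //.
exact: measurableT_comp (mN _).
Qed.

HB.instance Definition _ (n : nat) (t : R) :=
  isMeasurableFun.Build _ _ _ _ (centered_traffic n t)
    (measurable_centered_traffic n t).

End scheduled_traffic.

Arguments cvg_in_distribution {R disp T} P {disp' T'} P' {m} X Y.

(* Main.v *)
From HB Require Import structures.
Require Import Defs.
From mathcomp Require Import ring lra zify.
Set Implicit Arguments.
Unset Strict Implicit.
Unset Printing Implicit Defensive.
Import Order.TTheory GRing.Theory Num.Theory.
Import numFieldNormedType.Exports.
Local Open Scope classical_set_scope.
Local Open Scope ring_scope.

(** Write s = n t. A customer scheduled at some j <= 0 is counted in ]0, s] when
    it is late at time 0 (arrives after 0) but not late at s, and a customer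
    scheduled at 1 <= j <= s is counted unless it is late at s. Hence
    N_0(s) - floor(s) is the number of customers late at time 0 minus the number
    late at time s, if one restricts both counts to customers that are scheduled
    shortly before the time in question. Let B_u count the customers late at
    time n u among the K = floor(delta n) last ones scheduled before n u. The
    tail of xi is at most C / (1 + x), so what this restriction drops has a
    bounded mean ([traffic_count_decomposition], [traffic_remainder]), while
    E B_u is a sum of P(xi > k + theta) over k < K, hence equivalent to
    c log n ([cvg_block_sum]). After division by sqrt(log n) only
    V_n(0) - V_n(t) survives, where V_n(u) = (B_u - E B_u) / sqrt(log n).

    For delta small the blocks at distinct times involve disjoint sets of the
    xi_j. Thus linear combinations of the V_n(u) are centred sums of independent
    indicators, with small weights and a variance that converges because the
    squares of the probabilities are summable. The limits of the V_n(u) are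
    independent N(0, c), and the vector of their differences with V_n(0) has
    variance 2 c, covariance c, and vanishes at t = 0, as sqrt(c) Z does.

    The law of Z is known through linear combinations only, so the test functions
    are the waves x |-> cos(<a, x> + theta). For the indicator sums
    ([centered_sum_cos]), conditioning on one indicator at a time multiplies a
    wave by exp(- b^2 p / 2), up to an error controlled by Taylor expansion. For
    Gaussian laws ([gaussian_law_cos]), Stein's identity is a differential
    equation for the mean of the wave. From waves to bounded continuous functions
    ([cvg_in_distribution_cos]), tightness and uniform approximation on compact
    sets are merged into a single pointwise bound: a bounded continuous f is
    within e (1 + |x_1| + ... + |x_m|) of a trigonometric polynomial
    ([trig_approx]), and first moments stay bounded. *)

(** * Taylor estimates for the cosine *)

Section trig_inequalities.
Context {R : realType}.
Implicit Types x y : R.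

(** The mean value inequality, based at 0: each estimate below follows from the
    previous one by integrating it. *)
Lemma norm_increment_le (f df : R -> R) (y M : R) :
    (forall x, is_derive x 1 f (df x)) ->
    (forall z, `|z| <= `|y| -> `|df z| <= M) ->
  `|f y - f 0| <= M * `|y|.
Proof.
move=> fdf dfM.
have cf : continuous f.
  by move=> x; apply/differentiable_continuous/derivable1_diffP; case: (fdf x).
have [y0|y0] := leP 0 y.
- have [c] := MVT_segment y0 (fun x _ => fdf x) (continuous_subspaceT cf).
  rewrite in_itv/= => /andP[c0 cy] ->.
  by rewrite subr0 normrM ler_wpM2r// dfM// !ger0_norm.
- have [c] := MVT_segment (ltW y0) (fun x _ => fdf x) (continuous_subspaceT cf).
  rewrite in_itv/= => /andP[c0 cy]; rewrite distrC => ->.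
  rewrite sub0r normrM normrN ler_wpM2r// dfM// !ler0_norm ?lerN2//.
  exact: ltW.
Qed.

Lemma norm_sin_le y : `|sin y| <= `|y|.
Proof.
rewrite -[sin y]subr0 -sin0 -[leRHS]mul1r.
apply: (@norm_increment_le sin cos) => z _; exact: cos_max.
Qed.

Lemma norm_cosB1_le y : `|cos y - 1| <= y ^+ 2.
Proof.
rewrite -cos0 -real_normK ?num_real// expr2.
apply: (@norm_increment_le cos (fun x => - sin x)) => z zy.
by rewrite normrN (le_trans (norm_sin_le z)).
Qed.

Lemma norm_sinB_le y : `|sin y - y| <= `|y| ^+ 3.
Proof.
have -> : sin y - y = (sin y - y) - (sin 0 - 0) by rewrite sin0; ring.
rewrite exprSr.
apply: (@norm_increment_le (fun x => sin x - x) (fun x => cos x - 1)) => z zy.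
by rewrite (le_trans (norm_cosB1_le z))// -real_normK ?num_real// lerXn2r.
Qed.

Lemma norm_cos_taylor2_le y : `|y| <= 1 -> `|cos y - 1 + y ^+ 2 / 2| <= `|y| ^+ 3.
Proof.
move=> y1.
have -> : cos y - 1 + y ^+ 2 / 2 =
   (cos y - 1 + y ^+ 2 / 2) - (cos 0 - 1 + 0 ^+ 2 / 2).
  by rewrite cos0; ring.
rewrite [leRHS]exprSr.
apply: (@norm_increment_le (fun x => cos x - 1 + x ^+ 2 / 2)
  (fun x => x - sin x)) => [x|z zy].
  by apply: is_derive_eq; rewrite /GRing.scale/=; field.
rewrite distrC (le_trans (norm_sinB_le z))//.
rewrite (@le_trans _ _ (`|y| ^+ 3))//; first by rewrite lerXn2r.
by rewrite exprS ler_piMl// exprn_ge0.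
Qed.

(** No smallness of y is assumed, which allows y to be a multiple of a Gaussian
    variable; for large y the trivial bounds on sine and cosine take over. *)
Lemma cos_increment1 x y : `|cos (x + y) - cos x + y * sin x| <= 3 * y ^+ 2.
Proof.
have ysin : `|sin y - y| <= 2 * y ^+ 2.
  rewrite -(real_normK (num_real y)); have [y1|y1] := leP `|y| 1.
    rewrite (le_trans (norm_sinB_le y))// exprS ler_wpM2r ?exprn_ge0//.
    by rewrite (le_trans y1)// ler1n.
  rewrite (le_trans (ler_normB _ _))//; have := norm_sin_le y.
  move: y1; set a := `|sin y|; set b := `|y| => y1 ab.
  by nra.
rewrite cosD.
have -> : cos x * cos y - sin x * sin y - cos x + y * sin x =
  cos x * (cos y - 1) - sin x * (sin y - y) by ring.
rewrite (le_trans (ler_normB _ _))// -[3]/(1 + 2)%:R natrD mulrDl mul1r lerD//.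
  by rewrite normrM (le_trans (ler_piMl _ (cos_max x)))// norm_cosB1_le.
by rewrite normrM (le_trans (ler_piMl _ (sin_max x))).
Qed.

Lemma cos_increment2 x y : `|y| <= 1 ->
  `|cos (x + y) - (1 - y ^+ 2 / 2) * cos x + y * sin x| <= 2 * `|y| ^+ 3.
Proof.
move=> y1; rewrite cosD.
have -> : cos x * cos y - sin x * sin y - (1 - y ^+ 2 / 2) * cos x + y * sin x =
  cos x * (cos y - 1 + y ^+ 2 / 2) - sin x * (sin y - y) by field.
rewrite (le_trans (ler_normB _ _))// mulrDl !mul1r lerD//.
  by rewrite normrM (le_trans (ler_piMl _ (cos_max x)))// norm_cos_taylor2_le.
by rewrite normrM (le_trans (ler_piMl _ (sin_max x)))// norm_sinB_le.
Qed.

Lemma expRN_increment y : 0 <= y -> `|expR (- y) - (1 - y)| <= y ^+ 2.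
Proof.
move=> y0; rewrite ger0_norm ?subr_ge0 ?expR_ge1Dx//.
have y10 : 0 < 1 + y by lra.
have : expR (- y) <= (1 + y)^-1 by rewrite expRN lef_pV2 ?posrE ?expR_gt0// expR_ge1Dx.
have : (1 + y)^-1 <= 1 - y + y ^+ 2.
  rewrite -[leLHS]mul1r ler_pdivrMr//.
  have : 0 <= y ^+ 3 by rewrite exprn_ge0.
  have -> : (1 - y + y ^+ 2) * (1 + y) = 1 + y ^+ 3 by ring.
  lra.
lra.
Qed.

Lemma cos_lipschitz x y : `|cos x - cos y| <= `|x - y|.
Proof.
have -> : cos x - cos y = cos (y + (x - y)) - cos (y + 0) by rewrite addr0 (addrC y) subrK.
rewrite -[leRHS]mul1r.
apply: (@norm_increment_le (fun z => cos (y + z)) (fun z => - sin (y + z))) => [z|z _].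
  apply: is_derive_eq; rewrite /GRing.scale/=; ring.
by rewrite normrN sin_max.
Qed.

End trig_inequalities.

(** * Cosine moments of Gaussian laws *)

Section gaussian.
Context {R : realType}.
Notation mu := (@lebesgue_measure R).

(** The fundamental theorem of calculus on the segments [a - n, a + n], whose
    boundary terms vanish in the limit; dominated convergence handles the integral. *)
Lemma Rintegral_derivative_eq0 (G g : R -> R) (a : R) :
    (forall x : R, is_derive x 1 G (g x)) -> continuous g ->
    mu.-integrable setT (EFin \o g) ->
    G (a + n%:R) @[n --> \oo] --> 0 -> G (a - n%:R) @[n --> \oo] --> 0 ->
  \int[mu]_x g x = 0.
Proof.
move=> dG cg ig Gr Gl.
have cG : continuous G.
  by move=> x; apply/differentiable_continuous/derivable1_diffP; case: (dG x).
pose D n := `[a - n%:R, a + n%:R]%classic : set R.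
pose f n x := (EFin \o (g \_ (D n))) x.
have mf n : measurable_fun setT (f n).
  apply/measurable_EFinP; apply/(measurable_restrictT _ (measurable_itv `[a - n%:R, a + n%:R])).
  apply/measurable_funTS. exact: continuous_measurable_fun.
have fg x : f ^~ x @ \oo --> (g x)%:E.
  apply: cvg_near_cst; near=> n; rewrite /f /= patchE mem_set// /D /= in_itv/=.
  have : `|x - a| < n%:R by near: n; exact: nbhs_infty_gtr.
  by rewrite ltr_norml => /andP[? ?]; apply/andP; split; lra.
have lim1 : (\int[mu]_x f n x)%E @[n --> \oo] --> (\int[mu]_x (g x)%:E)%E.
  have [] := @dominated_convergence _ _ R mu setT measurableT f (EFin \o g)
    (fun x => `|g x|%:E) mf (measurable_int mu ig) _ (integrable_abse ig) _.
  - by apply/aeW => x _; exact: fg.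
  - apply/aeW => x n _; rewrite /f /= lee_fin patchE.
    by case: ifPn => // _; rewrite normr0.
  - by move=> _ _.
have lim2 : (\int[mu]_x f n x)%E @[n --> \oo] --> 0%E.
  have -> : 0%E = (0 - 0 : R)%:E by rewrite subr0.
  have : (G (a + n%:R) - G (a - n%:R))%:E @[n --> \oo] --> (0 - 0 : R)%:E.
    by apply: cvg_EFin; [exact: nearW|exact: cvgB].
  apply: cvg_trans; apply: near_eq_cvg; near=> n.
  have n0 : 0 < n%:R :> R by rewrite ltr0n; near: n; exact: nbhs_infty_gt.
  have -> : (\int[mu]_x f n x = \int[mu]_(x in D n) (g x)%:E)%E.
    rewrite [RHS]integral_mkcond; apply: eq_integral => x _.
    by rewrite /f /= !patchE; case: ifP.
  rewrite (@continuous_FTC2 _ g G)//.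
  - by lra.
  - exact: continuous_subspaceT.
  - split; last 2 first.
    + exact: (cvg_at_right_filter (cG _)).
    + exact: (cvg_at_left_filter (cG _)).
    + by move=> x _; case: (dG x).
  - by move=> x _; rewrite derive1E; apply: derive_val.
by rewrite /Rintegral (cvg_unique _ lim1 lim2).
Unshelve. all: by end_near. Qed.

Variables (m s : R).
Hypothesis s0 : s != 0.
Notation p := (normal_pdf m s).

(** Completing the square in the exponent. As all normal densities have mass 1,
    this provides every exponential moment without computing an integral. *)
Lemma normal_pdf_tilt (l x : R) :
  expR (l * (x - m)) * p x = expR (l ^+ 2 * s ^+ 2 / 2) * normal_pdf (m + l * s ^+ 2) s x.
Proof.
rewrite !normal_pdfE// /normal_fun mulrCA [RHS]mulrCA -!expRD; congr (_ * expR _).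
by field; rewrite s0.
Qed.

Let tilt_sum x := expR (x - m) * p x + expR (- (x - m)) * p x.

Lemma integrable_normal_exp : mu.-integrable setT (EFin \o tilt_sum).
Proof.
rewrite (_ : tilt_sum = fun x => expR (1 ^+ 2 * s ^+ 2 / 2) * normal_pdf (m + 1 * s ^+ 2) s x
  + expR ((-1) ^+ 2 * s ^+ 2 / 2) * normal_pdf (m + (-1) * s ^+ 2) s x); last first.
  by apply/funext => x; rewrite -(normal_pdf_tilt 1 x) -(normal_pdf_tilt (-1) x) mul1r mulN1r.
rewrite (_ : _ \o _ = (fun x => (expR (1 ^+ 2 * s ^+ 2 / 2))%:E * (normal_pdf (m + 1 * s ^+ 2)
    s x)%:E
  + (expR ((-1) ^+ 2 * s ^+ 2 / 2))%:E * (normal_pdf (m + (-1) * s ^+ 2) s x)%:E)%E)//.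
apply: integrableD => //; apply: integrableZl => //; exact: integrable_normal_pdf.
Qed.

Lemma expR_tail_ge (y : R) : 1 + `|y| + y ^+ 2 <= 3 * (expR y + expR (- y)).
Proof.
have h1 : 1 + `|y| <= expR `|y| by exact: expR_ge1Dx.
have h2 : 1 + `|y| ^+ 2 / 2 <= expR `|y|.
  by have := @expR_ge1Dxn R `|y| 1 (normr_ge0 _).
have h3 : expR `|y| <= expR y + expR (- y).
  by case: (ler0P y) => _; rewrite ?lerDl ?lerDr ?expR_ge0.
by move: h2; rewrite real_normK ?num_real// => h2; lra.
Qed.

Lemma normal_moment_le x : (1 + `|x - m| + (x - m) ^+ 2) * p x <= 3 * tilt_sum x.
Proof.
rewrite (le_trans (ler_wpM2r (normal_pdf_ge0 _ _ _) (expR_tail_ge _)))//.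
by rewrite /tilt_sum -mulrDl mulrA.
Qed.

Lemma integrable_normal_dom (h : R -> R) (C : R) : measurable_fun setT h ->
  (forall x, `|h x| <= C * (1 + `|x - m| + (x - m) ^+ 2)) ->
  mu.-integrable setT (EFin \o (fun x => h x * p x)).
Proof.
move=> mh hC.
apply: (@le_integrable _ _ _ mu setT measurableT _ (fun x => ((C * 3)%:E * (tilt_sum x)%:E)%E)).
- apply/measurable_EFinP/measurable_funM => //; exact: measurable_normal_pdf.
- move=> x _; rewrite /= lee_fin normrM (ger0_norm (normal_pdf_ge0 _ _ _)).
  have C0 : 0 <= C.
    rewrite leNgt; apply/negP => C0; have := hC m.
    by rewrite subrr normr0 expr0n/= !addr0 mulr1 leNgt (lt_le_trans C0)//.
  rewrite (le_trans (ler_wpM2r (normal_pdf_ge0 _ _ _) (hC x)))//.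
  rewrite -mulrA (le_trans (ler_wpM2l C0 (normal_moment_le x)))//.
  by rewrite mulrA ler_norm.
- by apply: integrableZl => //; exact: integrable_normal_exp.
Qed.


Notation nu := (normal_prob m s).

(** The density of the normal law coincides almost everywhere with its
    Radon-Nikodym derivative, for which the change of variables is known. *)
Lemma ge0_integral_normal_prob (F : R -> \bar R) : measurable_fun setT F ->
  (forall x, (0 <= F x)%E) ->
  (\int[nu]_x F x = \int[mu]_x (F x * (p x)%:E))%E.
Proof.
move=> mF F0.
have dom := @normal_prob_dominates R m s.
rewrite -(Radon_Nikodym_SigmaFinite.change_of_variables dom)//.
apply: ae_eq_integral => //.
- apply: emeasurable_funM => //.
  exact: measurable_int (Radon_Nikodym_SigmaFinite.f_integrable dom).
- by apply: emeasurable_funM => //; apply/measurable_EFinP; exact: measurable_normal_pdf.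
- apply: ae_eqe_mul2l; apply: integral_ae_eq => //.
  + exact: Radon_Nikodym_SigmaFinite.f_integrable.
  + by apply/measurable_EFinP; exact: measurable_normal_pdf.
  + by move=> E _ mE; rewrite -Radon_Nikodym_SigmaFinite.f_integral.
Qed.

Lemma integral_normal_prob (h : R -> R) (C : R) : measurable_fun setT h ->
    (forall x, `|h x| <= C * (1 + `|x - m| + (x - m) ^+ 2)) ->
  nu.-integrable setT (EFin \o h) /\
  \int[nu]_x h x = \int[mu]_x (h x * p x).
Proof.
move=> mh hC; have ih := integrable_normal_dom mh hC.
split.
  apply/integrableP; split; first exact/measurable_EFinP.
  rewrite ge0_integral_normal_prob//; last first.
    by apply/measurableT_comp => //; exact/measurable_EFinP.
  have /integrableP[_] := ih; congr (_ < _)%E; apply: eq_integral => x _.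
  by rewrite /= normrM (ger0_norm (normal_pdf_ge0 _ _ _)) EFinM.
congr fine; rewrite [LHS]integralE [RHS]integralE.
rewrite !ge0_integral_normal_prob//.
- congr (_ - _)%E; apply: eq_integral => x _.
    by rewrite !funeposE /= -!EFin_max -EFinM maxr_pMl ?normal_pdf_ge0// mul0r.
  rewrite !funenegE /= -!EFin_max -EFinM maxr_pMl ?normal_pdf_ge0//.
  by rewrite mul0r mulNr.
- by apply: measurable_funeneg; exact/measurable_EFinP.
- by apply: measurable_funepos; exact/measurable_EFinP.
Qed.

Lemma is_derive_normal_pdf (x : R) : is_derive x 1 p (- ((x - m) / s ^+ 2) * p x).
Proof.
rewrite normal_pdfE// /normal_fun.
apply: is_derive_eq; rewrite /GRing.scale/=; field.
by rewrite s0.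
Qed.

(** exp(- y) <= 1 / (1 + y): a quadratic decay is enough to kill the boundary terms
    of an integration by parts against functions of linear growth. *)
Lemma normal_pdf_decay (y : R) :
  p (m + y) * (1 + y ^+ 2 / (s ^+ 2 *+ 2)) <= normal_peak s.
Proof.
rewrite normal_pdfE// /normal_fun [m + y]addrC addrK -mulrA ler_piMr ?normal_peak_ge0//.
rewrite mulNr expRN mulrC ler_pdivrMr ?expR_gt0// mul1r.
exact: expR_ge1Dx.
Qed.

(** Stein's identity: the derivative of h times the density p is
    (h' - (x - m) h / s^2) p, and its integral over the line is 0. *)
Lemma normal_stein (h dh : R -> R) (C : R) :
    (forall x : R, is_derive x 1 h (dh x)) -> continuous dh ->
    (forall x, `|h x| <= C * (1 + `|x - m|)) -> (forall x, `|dh x| <= C) ->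
  \int[nu]_x ((x - m) * h x) = s ^+ 2 * \int[nu]_x dh x.
Proof.
move=> dhE cdh hC dhC.
have ch : continuous h.
  by move=> x; apply/differentiable_continuous/derivable1_diffP; case: (dhE x).
have C0 : 0 <= C by apply: le_trans (dhC m); exact: normr_ge0.
have mdh : measurable_fun setT dh by exact: continuous_measurable_fun.
have mh : measurable_fun setT h by exact: continuous_measurable_fun.
have mxh : measurable_fun setT (fun x : R => (x - m) * h x).
  by apply: measurable_funM => //; exact: measurable_funB.
have le1 x : `|dh x| <= C * (1 + `|x - m| + (x - m) ^+ 2).
  rewrite (le_trans (dhC _))// ler_peMr// -addrA lerDl addr_ge0//.
  exact: sqr_ge0.
have le2 x : `|(x - m) * h x| <= C * (1 + `|x - m| + (x - m) ^+ 2).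
  rewrite normrM (le_trans (ler_wpM2l _ (hC _)))// mulrCA ler_wpM2l//.
  rewrite mulrDr mulr1 -expr2 real_normK ?num_real//; lra.
have [_ ->] := integral_normal_prob mdh le1.
have [_ ->] := integral_normal_prob mxh le2.
have i1 := integrable_normal_dom mdh le1; have i2 := integrable_normal_dom mxh le2.
have lim0 (y : nat -> R) : (forall n, `|y n| = n%:R) ->
    h (m + y n) * p (m + y n) @[n --> \oo] --> 0.
  move=> yn; apply/norm_cvg0P.
  pose K := 2 + 4 * s ^+ 2.
  apply: (@squeeze_cvgr _ _ _ _ (cst 0) (fun n => C * normal_peak s * K * harmonic n)).
  - apply: nearW => n; rewrite normr_ge0/= normrM (ger0_norm (normal_pdf_ge0 _ _ _)).
    rewrite /harmonic /= ler_pdivlMr// -natr1.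
    have hy : `|h (m + y n)| <= C * (1 + n%:R).
      by rewrite (le_trans (hC _))// [m + _]addrC addrK yn.
    have := normal_pdf_decay (y n).
    rewrite -(real_normK (num_real (y n))) yn; set N : R := n%:R; set q := p _ => qN.
    have N0 : 0 <= N by exact: ler0n.
    have q0 : 0 <= q by exact: normal_pdf_ge0.
    have k0 := normal_peak_ge0 s.
    have NK : (N + 1) ^+ 2 <= K * (1 + N ^+ 2 / (s ^+ 2 *+ 2)).
      have -> : K * (1 + N ^+ 2 / (s ^+ 2 *+ 2)) =
        (2 + 2 * N ^+ 2) + (N ^+ 2 / s ^+ 2 + 4 * s ^+ 2) by rewrite /K; field; rewrite s0.
      have t0 : 0 <= N ^+ 2 / s ^+ 2 by rewrite divr_ge0// ?sqr_ge0 ?ltW.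
      have := sqr_ge0 (N - 1); nra.
    rewrite (@le_trans _ _ (C * (q * (N + 1) ^+ 2)))//.
      rewrite expr2 !mulrA ler_wpM2r ?addr_ge0// mulrAC ler_wpM2r//.
      by rewrite (addrC N).
    rewrite -!mulrA ler_wpM2l// [leRHS]mulrC.
    rewrite (le_trans (ler_wpM2l q0 NK))// mulrCA ler_wpM2l// addr_ge0// mulr_ge0//.
    exact: sqr_ge0.
  - exact: cvg_cst.
  - rewrite -(mulr0 (C * normal_peak s * K)); apply: cvgM; first exact: cvg_cst.
    exact: cvg_harmonic.
have := @Rintegral_derivative_eq0 (fun x => h x * p x)
  (fun x => dh x * p x - s ^- 2 * ((x - m) * h x * p x)) m.
rewrite RintegralB//; last first.
  rewrite (_ : _ \o _ = fun x => ((s ^- 2)%:E * ((x - m) * h x * p x)%:E)%E)//.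
  exact: integrableZl.
rewrite RintegralZl// => H.
suff : \int[mu]_x (dh x * p x) - s ^- 2 * \int[mu]_x ((x - m) * h x * p x) = 0.
  by move/eqP; rewrite subr_eq0 => /eqP ->; rewrite mulVKf// expf_neq0.
apply: H.
- move=> x; have := is_derive_normal_pdf x => dp; have := dhE x => dhx.
  by apply: is_derive_eq; rewrite /GRing.scale/=; field; rewrite s0.
- have cp := @continuous_normal_pdf R m s s0.
  move=> x; apply: cvgB; first by apply: cvgM; [exact: cdh|exact: cp].
  apply: cvgM; first exact: cvg_cst.
  apply: cvgM; last exact: cp.
  by apply: cvgM; [apply: cvgB; [exact: cvg_id|exact: cvg_cst]|exact: ch].
- rewrite (_ : _ \o _ = fun x => ((dh x * p x)%:E - (s ^- 2)%:E * ((x - m) * h x * p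
    x)%:E)%E)//.
  by apply: integrableB => //; exact: integrableZl.
- by apply: (lim0 (fun n => n%:R)) => n; rewrite normr_nat.
- by apply: (lim0 (fun n => - n%:R)) => n; rewrite normrN normr_nat.
Qed.


Lemma normal_prob_fineT : fine (nu setT) = 1.
Proof. by rewrite /normal_prob integral_normal_pdf. Qed.

Lemma integral_normal_prob_center : \int[nu]_x (x - m) = 0.
Proof.
transitivity (\int[nu]_x ((x - m) * (1 : R))).
  by apply: eq_Rintegral => x _; rewrite mulr1.
rewrite (@normal_stein (fun=> 1 : R) (fun=> 0 : R) 1).
- by rewrite Rintegral_cst// mul0r mulr0.
- by move=> x; exact: cst_continuous.
- by move=> x; rewrite /= normr1 mul1r lerDl.
- by move=> x; rewrite /= normr0.
Qed.

Lemma integral_normal_prob_sqr : \int[nu]_x ((x - m) ^+ 2) = s ^+ 2.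
Proof.
transitivity (\int[nu]_x ((x - m) * (x - m))).
  by apply: eq_Rintegral => x _; rewrite expr2.
transitivity (s ^+ 2 * \int[nu]_x (1 : R)); last first.
  by rewrite Rintegral_cst//= normal_prob_fineT !mulr1.
apply: (@normal_stein (fun x => x - m) (fun=> 1 : R) 1).
- by move=> x; apply: is_derive_eq; rewrite subr0.
- by move=> x; exact: cst_continuous.
- by move=> x; rewrite mul1r lerDr.
- by move=> x; rewrite /= normr1.
Qed.

(** A quadratic remainder is often easier to integrate than a difference quotient:
    here it replaces differentiation under the integral sign. *)
Lemma is_derive_of_sqr_bound (F : R -> R) (u D M : R) :
  (forall h, `|F (u + h) - F u - h * D| <= M * h ^+ 2) -> is_derive u 1 F D.
Proof.
move=> FM.
have M0 : 0 <= M by have := FM 1; rewrite expr1n mulr1; apply: le_trans.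
have lim : h^-1 *: (F (h *: (1 : R) + u) - F u) @[h --> 0^'] --> D.
  apply/cvgrPdist_le => e e0.
  near=> h.
  have h0 : h != 0 by near: h; exact: nbhs_dnbhs_neq.
  have hM : `|h| * (M + 1) <= e.
    rewrite -ler_pdivlMr; last by lra.
    near: h; apply: dnbhs0_le; rewrite divr_gt0//; lra.
  have H := FM h.
  rewrite distrC /GRing.scale/= mulr1 (addrC h u).
  have -> : h^-1 * (F (u + h) - F u) - D = h^-1 * (F (u + h) - F u - h * D) by field.
  rewrite normrM normfV ler_pdivrMl ?normr_gt0// (le_trans H)//.
  rewrite -(real_normK (num_real h)) expr2 mulrCA ler_wpM2l// (le_trans _ hM)//.
  rewrite mulrC ler_wpM2l//; lra.
apply: DeriveDef; first by apply/cvg_ex; exists D.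
exact/cvg_lim.
Unshelve. all: by end_near. Qed.

(** Let F(u) be the integral. By Stein's identity F'(u) = - s^2 u F(u), so that
    F(u) exp(u^2 s^2 / 2) is constant. *)
Lemma integral_normal_prob_cos (u th : R) :
  \int[nu]_x cos (u * (x - m) + th) = expR (- (u ^+ 2 * s ^+ 2 / 2)) * cos th.
Proof.
have mcos a b : measurable_fun setT (fun x : R => cos (a * (x - m) + b)).
  apply: continuous_measurable_fun => x.
  apply: (@continuous_comp _ _ _ (fun x => a * (x - m) + b) cos); last exact: continuous_cos.
  apply: cvgD; last exact: cvg_cst.
  apply: cvgM; first exact: cvg_cst.
  by apply: cvgB; [exact: cvg_id|exact: cvg_cst].
have msin a b : measurable_fun setT (fun x : R => (x - m) * sin (a * (x - m) + b)).
  apply: continuous_measurable_fun => x.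
  apply: cvgM; first by apply: cvgB; [exact: cvg_id|exact: cvg_cst].
  apply: (@continuous_comp _ _ _ (fun x => a * (x - m) + b) sin); last exact: continuous_sin.
  apply: cvgD; last exact: cvg_cst.
  apply: cvgM; first exact: cvg_cst.
  by apply: cvgB; [exact: cvg_id|exact: cvg_cst].
have msqr : measurable_fun setT (fun x : R => (x - m) ^+ 2).
  by apply: measurable_funX; exact: measurable_funB.
have bcos a b x : `|cos (a * (x - m) + b)| <= 1 * (1 + `|x - m| + (x - m) ^+ 2).
  rewrite (le_trans (cos_max _))// mul1r -addrA lerDl addr_ge0//; exact: sqr_ge0.
have bsin a b x : `|(x - m) * sin (a * (x - m) + b)| <= 1 * (1 + `|x - m| + (x - m) ^+ 2).
  rewrite mul1r normrM (le_trans (ler_piMr _ (sin_max _)))//.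
  by rewrite addrAC lerDr addr_ge0// sqr_ge0.
have bsqr x : `|(x - m) ^+ 2| <= 1 * (1 + `|x - m| + (x - m) ^+ 2).
  by rewrite mul1r ger0_norm ?sqr_ge0// lerDr addr_ge0.
pose F a := \int[nu]_x cos (a * (x - m) + th).
have dF (a : R) : is_derive a 1 F (- (s ^+ 2 * a * F a)).
  have -> : - (s ^+ 2 * a * F a) = - \int[nu]_x ((x - m) * sin (a * (x - m) + th)).
    congr (- _); transitivity (s ^+ 2 * \int[nu]_x (a * cos (a * (x - m) + th))).
      rewrite RintegralZl ?mulrA//; by have [] := integral_normal_prob (mcos a th) (bcos a th).
    apply/esym/(@normal_stein (fun x => sin (a * (x - m) + th)) (fun x => a * cos (a * (x - m)
        + th)) (1 + `|a|)).
    - by move=> x; apply: is_derive_eq; rewrite /GRing.scale/=; ring.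
    - move=> x; apply: cvgM; first exact: cvg_cst.
      apply: (@continuous_comp _ _ _ (fun x => a * (x - m) + th) cos); last exact:
          continuous_cos.
      apply: cvgD; last exact: cvg_cst.
      apply: cvgM; first exact: cvg_cst.
      by apply: cvgB; [exact: cvg_id|exact: cvg_cst].
    - move=> x; rewrite (le_trans (sin_max _))// mulrDl mul1r mulrDr mulr1 -addrA lerDl.
      by rewrite !addr_ge0// mulr_ge0// addr_ge0.
    - move=> x; rewrite normrM (le_trans (ler_piMr _ (cos_max _)))// lerDr//.
  have [ic _] := integral_normal_prob (mcos a th) (bcos a th).
  have [isn _] := integral_normal_prob (msin a th) (bsin a th).
  have [iq _] := integral_normal_prob msqr bsqr.
  apply: (@is_derive_of_sqr_bound _ _ _ (3 * s ^+ 2)) => h.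
  have [ich _] := integral_normal_prob (mcos (a + h) th) (bcos (a + h) th).
  have ihs : nu.-integrable setT (EFin \o (fun x => h * ((x - m) * sin (a * (x - m) + th)))).
    rewrite (_ : _ \o _ = fun x => (h%:E * ((x - m) * sin (a * (x - m) + th))%:E)%E)//.
    exact: integrableZl.
  have icc : nu.-integrable setT (EFin \o (fun x => cos ((a + h) * (x - m) + th) - cos (a * (x
      - m) + th))).
    rewrite (_ : _ \o _ = fun x => ((cos ((a + h) * (x - m) + th))%:E - (cos (a * (x - m) +
        th))%:E)%E)//.
    exact: integrableB.
  rewrite mulrN opprK /F -RintegralB// -RintegralZl// -RintegralD//.
  have iall : nu.-integrable setT (EFin \o (fun x => (cos ((a + h) * (x - m) + th) - cos (a *
      (x - m) + th))
     + h * ((x - m) * sin (a * (x - m) + th)))).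
    rewrite (_ : _ \o _ = fun x => ((cos ((a + h) * (x - m) + th) - cos (a * (x - m) + th))%:E
      + (h * ((x - m) * sin (a * (x - m) + th)))%:E)%E)//.
    exact: integrableD.
  rewrite (le_trans (le_normr_Rintegral _ iall))// -integral_normal_prob_sqr.
  rewrite mulrAC -RintegralZl//; apply: le_Rintegral => //.
  - exact: integrable_norm.
  - rewrite (_ : _ \o _ = fun x => ((3 * h ^+ 2)%:E * ((x - m) ^+ 2)%:E)%E)//.
    exact: integrableZl.
  - move=> x _; have := cos_increment1 (a * (x - m) + th) (h * (x - m)).
    rewrite exprMn mulrA; apply: le_trans; rewrite le_eqVlt; apply/orP; left; apply/eqP.
    by congr (`| _ |); rewrite mulrA; congr (cos _ - _ + _); ring.
pose H a := F a * expR (a ^+ 2 * s ^+ 2 / 2).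
have dH (a : R) : is_derive a 1 H 0.
  have := dF a => dFa; apply: is_derive_eq; rewrite /GRing.scale/=; by field.
have := is_derive_0_is_cst u 0 dH.
rewrite /H expr0n/= !mul0r expR0 mulr1.
have -> : F 0 = cos th.
  rewrite /F; under eq_Rintegral do rewrite mul0r add0r.
  by rewrite Rintegral_cst//= normal_prob_fineT mulr1.
by move=> <-; rewrite mulrCA -expRD addNr expR0 mulr1.
Qed.

End gaussian.

Section gaussian_variable.
Context (d : measure_display) (T : measurableType d) (R : realType).
Context (P : probability T R).

(** The codomain is an arbitrary measurable type because the normal law lives on the
    real line generated by half-open intervals, a structure distinct from the
    canonical one although it has the same measurable sets. *)
Lemma integral_of_law (d' : measure_display) (T' : measurableType d')
    (W : {RV P >-> T'}) (nu : {measure set T' -> \bar R}) (f : T' -> R) :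
    (forall A, measurable A -> P (W @^-1` A) = nu A) -> measurable_fun setT f ->
    nu.-integrable setT (EFin \o f) ->
  P.-integrable setT (EFin \o (f \o W)) /\
  \int[P]_w f (W w) = \int[nu]_x f x.
Proof.
move=> law mf inf.
have eqd (g : T' -> \bar R) : (\int[distribution P W]_x g x = \int[nu]_x g x)%E.
  by apply: eq_measure_integral => A mA _; exact: law.
have iW : P.-integrable setT (EFin \o (f \o W)).
  apply/integrableP; split; first exact/measurable_EFinP/measurableT_comp.
  have /integrableP[_] := inf; rewrite -eqd ge0_integral_distribution//.
  by apply/measurableT_comp => //; exact/measurable_EFinP.
split => //; congr fine.
rewrite -eqd integral_distribution//; exact/measurable_EFinP.
Qed.

(** The parameters m and s of the law are recovered from the first two moments, by
    Stein's identity with h = 1 and h(x) = x - m. *)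
Lemma gaussian_law_cos (W : {RV P >-> R}) (m s v th : R) :
    (forall A, measurable A -> P (W @^-1` A) = gaussian_law m s A) ->
    \int[P]_w W w = 0 -> \int[P]_w (W w ^+ 2) = v ->
  \int[P]_w cos (W w + th) = expR (- (v / 2)) * cos th.
Proof.
have mcos : measurable_fun setT (fun x : R => cos (x + th)).
  apply: continuous_measurable_fun => x.
  apply: (@continuous_comp _ _ _ (fun x => x + th) cos); last exact: continuous_cos.
  by apply: cvgD; [exact: cvg_id|exact: cvg_cst].
have mid : measurable_fun setT (fun x : R => x) by [].
have msqr : measurable_fun setT (fun x : R => x ^+ 2) by exact: exprn_measurable.
rewrite /gaussian_law; have [_|s0] := eqVneq s 0.
  move=> law.
  have idirac (f : R -> R) : measurable_fun setT f ->
      (dirac m).-integrable setT (EFin \o f) /\ \int[dirac m]_x f x = f m.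
    move=> mf; split.
      apply/integrableP; split; first exact/measurable_EFinP.
      rewrite integral_dirac//; last by apply/measurableT_comp => //; exact/measurable_EFinP.
      by rewrite diracT mul1e ltry.
    rewrite /Rintegral integral_dirac//; last exact/measurable_EFinP.
    by rewrite diracT mul1e.
  have tr (f : R -> R) (mf : measurable_fun setT f) : \int[P]_w f (W w) = f m.
    have [ifm <-] := idirac _ mf.
    by have [] := integral_of_law law mf ifm.
  rewrite (tr _ mid) (tr _ msqr) (tr _ mcos) => -> <-.
  by rewrite expr0n/= mul0r oppr0 expR0 mul1r add0r.
move=> law.
have mW : measurable_fun setT (W : T -> measurableTypeR R) by exact: (@measurable_funPT _ _ _
    _ W).
pose W' : {RV P >-> measurableTypeR R} :=
  HB.pack (W : T -> measurableTypeR R) (isMeasurableFun.Build _ _ _ _ _ mW).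
have b1 x : `|x| <= (1 + `|m|) * (1 + `|x - m| + (x - m) ^+ 2).
  have : `|x| <= `|x - m| + `|m| by rewrite -{1}(subrK m x) ler_normD.
  have := normr_ge0 m; have := normr_ge0 (x - m); have := sqr_ge0 (x - m); nra.
have b2 x : `|x ^+ 2| <= (2 + 2 * m ^+ 2) * (1 + `|x - m| + (x - m) ^+ 2).
  rewrite ger0_norm ?sqr_ge0//; have := normr_ge0 (x - m).
  have := sqr_ge0 (x - m - m); have := sqr_ge0 (x - m); have := sqr_ge0 m.
  nra.
have b3 x : `|cos (x + th)| <= 1 * (1 + `|x - m| + (x - m) ^+ 2).
  rewrite (le_trans (cos_max _))// mul1r -addrA lerDl addr_ge0//; exact: sqr_ge0.
have tr (f : R -> R) C (mf : measurable_fun setT f)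
    (bf : forall x, `|f x| <= C * (1 + `|x - m| + (x - m) ^+ 2)) :
    (normal_prob m s).-integrable setT (EFin \o f) /\
    \int[P]_w f (W w) = \int[normal_prob m s]_x f x.
  have [ifm _] := integral_normal_prob s0 mf bf.
  by have [] := @integral_of_law _ _ W' (normal_prob m s) f law mf ifm.
have [i1 ->] := tr _ _ mid b1.
have [i2 ->] := tr _ _ msqr b2.
have [i3 ->] := tr _ _ mcos b3.
move=> m0 v0.
have {}m0 : m = 0.
  have := integral_normal_prob_center m s0.
  have ic : (normal_prob m s).-integrable setT (EFin \o cst m).
    exact: finite_measure_integrable_cst.
  by rewrite RintegralB// m0 Rintegral_cst//= normal_prob_fineT// mulr1 add0r => /eqP;
     rewrite oppr_eq0 => /eqP.
subst m.
have := integral_normal_prob_sqr 0 s0; under eq_Rintegral do rewrite subr0.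
rewrite v0 => ->.
have := @integral_normal_prob_cos R 0 s s0 1 th.
under eq_Rintegral do rewrite subr0 mul1r.
by move=> ->; rewrite expr1n mul1r.
Qed.

End gaussian_variable.

(** * Trigonometric approximation of continuous functions *)

Section bernstein.
Context {R : realType}.
Implicit Types (N : nat) (s : R) (ss : seq R) (ks : seq nat).

(** The mean of h(k) for k binomial with parameters N and s, defined by
    conditioning on one trial rather than by binomial coefficients. The recursion
    makes positivity, the variance and polynomiality in s immediate. *)
Fixpoint bernstein N s (h : nat -> R) : R :=
  if N is N'.+1 then (1 - s) * bernstein N' s h + s * bernstein N' s (h \o S)
  else h 0%N.

(** The mean of h over independent binomial variables, one for each entry of ss. *)
Fixpoint bernstein_seq N ss (h : seq nat -> R) : R :=
  if ss is s :: ss' then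
    bernstein N s (fun k => bernstein_seq N ss' (fun ks => h (k :: ks)))
  else h [::].

Fixpoint deviation N ss ks : R :=
  if (ss, ks) is (s :: ss', k :: ks') then
    (k%:R - N%:R * s) ^+ 2 + deviation N ss' ks'
  else 0.

Lemma bernstein_le N s (h h' : nat -> R) : 0 <= s <= 1 ->
  (forall k, h k <= h' k) -> bernstein N s h <= bernstein N s h'.
Proof.
move=> /andP[s0 s1]; elim: N h h' => [|N IH] h h' hh' //=.
by rewrite lerD// ler_wpM2l ?subr_ge0 ?IH// => k; exact: hh'.
Qed.

Lemma bernstein_affine N s (h : nat -> R) a c :
  bernstein N s (fun k => a * h k + c) = a * bernstein N s h + c.
Proof.
elim: N h => [|N IH] h //=.
rewrite (_ : _ \o S = fun k => a * (h \o S) k + c)// !IH; ring.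
Qed.

Lemma bernstein_sqr N s c :
  bernstein N s (fun k => (k%:R - c) ^+ 2) = N%:R * s * (1 - s) + (N%:R * s - c) ^+ 2.
Proof.
elim: N c => [|N IH] c /=; first by rewrite mulr0n !mul0r !add0r.
rewrite IH; have -> : (fun k => (k%:R - c) ^+ 2) \o S = (fun k => (k%:R - (c - 1)) ^+ 2).
  by apply/funext => k /=; rewrite -natr1; congr (_ ^+ 2); ring.
rewrite IH -natr1; ring.
Qed.

Lemma bernstein_seq_le N ss (h h' : seq nat -> R) : {in ss, forall s, 0 <= s <= 1} ->
    (forall ks, size ks = size ss -> h ks <= h' ks) ->
  bernstein_seq N ss h <= bernstein_seq N ss h'.
Proof.
elim: ss h h' => [|s ss IH] h h' ss01 hh' /=; first exact: hh'.
apply: bernstein_le => [|k]; first by rewrite ss01// mem_head.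
apply: IH => [s' s'ss|ks sks]; first by rewrite ss01// in_cons s'ss orbT.
by apply: hh'; rewrite /= sks.
Qed.

Lemma bernstein_seq_affine N ss (h : seq nat -> R) a c :
  bernstein_seq N ss (fun ks => a * h ks + c) = a * bernstein_seq N ss h + c.
Proof.
elim: ss h => [|s ss IH] h //=; rewrite -bernstein_affine.
by congr (bernstein _ _ _); apply/funext => k; rewrite IH.
Qed.

(** The variance of a binomial variable is at most N in each coordinate. *)
Lemma bernstein_seq_deviation N ss : {in ss, forall s, 0 <= s <= 1} ->
  bernstein_seq N ss (deviation N ss) <= (size ss)%:R * N%:R.
Proof.
elim: ss => [|s ss IH] ss01 /=; first by rewrite mul0r.
have /andP[s0 s1] : 0 <= s <= 1 by rewrite ss01// mem_head.
set B := bernstein_seq N ss (deviation N ss).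
have -> : (fun k => bernstein_seq N ss (fun ks => (k%:R - N%:R * s) ^+ 2 + deviation N ss ks)) =
   (fun k => 1 * (k%:R - N%:R * s) ^+ 2 + B).
  apply/funext => k; rewrite mul1r [RHS]addrC -[B]mul1r -bernstein_seq_affine.
  by congr (bernstein_seq _ _ _); apply/funext => ks; rewrite mul1r addrC.
rewrite bernstein_affine bernstein_sqr subrr expr0n addr0 mul1r -natr1 mulrDl addrC mul1r.
apply: lerD.
  by apply: IH => s' s'ss; rewrite ss01// in_cons s'ss orbT.
rewrite -mulrA ler_piMr// mulr_ile1// ?subr_ge0//; lra.
Qed.

Lemma deviation_ge0 N ss ks : 0 <= deviation N ss ks.
Proof. by elim: ss ks => [|s ss IH] [|k ks] //=; rewrite addr_ge0 ?sqr_ge0. Qed.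

Lemma deviation_ge N ss ks i : size ks = size ss -> (i < size ss)%N ->
  ((nth 0%N ks i)%:R - N%:R * nth 0 ss i) ^+ 2 <= deviation N ss ks.
Proof.
elim: ss ks i => [|s ss IH] [|k ks] [|i] //= [sks] iss.
  by rewrite lerDl deviation_ge0.
by rewrite (le_trans (IH _ _ sks iss))// lerDr sqr_ge0.
Qed.

End bernstein.

Section trigonometric_polynomials.
Context {R : realType} {m : nat}.
Implicit Types (x : 'rV[R]_m) (a : 'I_m -> R).

Definition dot a x : R := \sum_i a i * x ord0 i.

Inductive trig_poly : ('rV[R]_m -> R) -> Prop :=
| trig_wave c a th : trig_poly (fun x => c * cos (dot a x + th))
| trig_add f g : trig_poly f -> trig_poly g -> trig_poly (fun x => f x + g x).

Lemma trig_cst c : trig_poly (fun=> c).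
Proof.
have -> : (fun=> c) = (fun x => c * cos (dot (fun=> 0) x + 0)).
  apply/funext => x; rewrite /dot big1 ?addr0 ?cos0 ?mulr1// => i _.
  by rewrite mul0r.
exact: trig_wave.
Qed.

(** The product formula for cosines. *)
Lemma trig_mul f g : trig_poly f -> trig_poly g -> trig_poly (fun x => f x * g x).
Proof.
move=> tf; elim: tf g => [c a th|f1 f2 _ IH1 _ IH2] g tg; last first.
  have -> : (fun x => (f1 x + f2 x) * g x) = (fun x => f1 x * g x + f2 x * g x).
    by apply/funext => x; rewrite mulrDl.
  by apply: trig_add; [exact: IH1|exact: IH2].
elim: tg => [c' a' th'|g1 g2 _ IH1 _ IH2]; last first.
  have -> : (fun x => c * cos (dot a x + th) * (g1 x + g2 x)) =
    (fun x => c * cos (dot a x + th) * g1 x + c * cos (dot a x + th) * g2 x).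
    by apply/funext => x; rewrite mulrDr.
  exact: trig_add.
have -> : (fun x => c * cos (dot a x + th) * (c' * cos (dot a' x + th'))) =
  (fun x => (c * c' / 2) * cos (dot (fun i => a i + a' i) x + (th + th')) +
            (c * c' / 2) * cos (dot (fun i => a i - a' i) x + (th - th'))).
  apply/funext => x; set A := dot a x + th; set B := dot a' x + th'.
  have -> : dot (fun i => a i + a' i) x + (th + th') = A + B.
    by rewrite /A /B /dot addrACA -big_split/=; congr (_ + _); apply: eq_bigr => i _; rewrite
        mulrDl.
  have -> : dot (fun i => a i - a' i) x + (th - th') = A - B.
    rewrite /A /B /dot opprD addrACA -sumrB; congr (_ + _).
    by apply: eq_bigr => i _; rewrite mulrBl.
  by rewrite (cosD A B) (cosB A B); field.
by apply: trig_add; exact: trig_wave.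
Qed.

Lemma trig_sin i (k : R) : trig_poly (fun x => (1 + sin (k * x ord0 i)) / 2).
Proof.
have -> : (fun x => (1 + sin (k * x ord0 i)) / 2) =
  (fun x => 2^-1 + 2^-1 * cos (dot (fun j => if j == i then k else 0) x + - (pi / 2))).
  apply/funext => x; rewrite cosBpihalf /dot (bigD1 i)//= eqxx big1 ?addr0.
    by field.
  by move=> j /negbTE ->; rewrite mul0r.
by apply: trig_add; [exact: trig_cst|exact: trig_wave].
Qed.

Lemma trig_bernstein N (s : 'rV[R]_m -> R) (h : nat -> 'rV[R]_m -> R) :
  trig_poly s -> (forall k, trig_poly (h k)) ->
  trig_poly (fun x => bernstein N (s x) (fun k => h k x)).
Proof.
move=> ts; elim: N h => [|N IH] h th /=; first exact: th.
apply: trig_add; apply: trig_mul => //; first 2 last.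
- exact: (IH (fun k => h k.+1)).
- have -> : (fun x => 1 - s x) = (fun x => 1 + (-1) * s x).
    by apply/funext => x; rewrite mulN1r.
  by apply: trig_add; [exact: trig_cst|apply: trig_mul => //; exact: trig_cst].
- exact: IH.
Qed.

Lemma trig_bernstein_seq N (ss : seq ('rV[R]_m -> R)) (h : seq nat -> R) :
  (forall i, (i < size ss)%N -> trig_poly (nth (fun=> 0) ss i)) ->
  trig_poly (fun x => bernstein_seq N [seq s x | s <- ss] h).
Proof.
elim: ss h => [|s ss IH] h tss /=; first exact: trig_cst.
apply: (@trig_bernstein N s (fun k x => bernstein_seq N [seq s x | s <- ss] (fun ks => h (k ::
    ks)))).
  exact: (tss 0%N).
by move=> k; apply: IH => i iss; exact: (tss i.+1).
Qed.

End trigonometric_polynomials.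

Section approximation.
Context {R : realType}.

(** The Heine-Cantor theorem, with only one of the two points in the compact set. *)
Lemma compact_uniformly_continuous (V : normedModType R) (A : set V) (f : V -> R) (e : R) :
    compact A -> continuous f -> 0 < e ->
  exists2 d, 0 < d & forall x y, A x -> `|x - y| < d -> `|f x - f y| <= e.
Proof.
move=> /compact_near_coveringP cA cf e0.
have e20 : 0 < e / 2 by rewrite divr_gt0.
have /cA := at_right_proper_filter (0 : R).
move/(_ (fun d x => forall y, `|x - y| < d -> `|f x - f y| <= e)) => H.
have {H} : \forall d \near (0 : R)^'+,
    A `<=` (fun x => forall y, `|x - y| < d -> `|f x - f y| <= e).
  apply: H => x Ax.
  have /cvgrPdist_lt /(_ _ e20) /nbhs_ballP[r /= r0 fr] := cf x.
  have r20 : 0 < r / 2 by rewrite divr_gt0.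
  exists (ball x (r / 2), [set d | d < r / 2]) => /=.
    by split; [exact: nbhsx_ballx|exact: nbhs_right_lt].
  move=> [x' d] /= [xx' dr] y x'y.
  have fx' : `|f x - f x'| < e / 2.
    by apply: fr; apply: le_ball xx'; rewrite ler_pdivrMr// ler_peMr// ?ler1n// ltW.
  have fy : `|f x - f y| < e / 2.
    apply: fr; rewrite [r]splitr; apply: (ball_triangle xx').
    by rewrite -ball_normE /=; exact: lt_trans dr.
  have := ler_distD (f x) (f x') (f y); rewrite (distrC (f x') (f x)); lra.
move=> H; near (0 : R)^'+ => d.
have dA : A `<=` (fun x => forall y, `|x - y| < d -> `|f x - f y| <= e).
  by near: d.
by exists d => // x y /dA; exact.
Unshelve. all: by end_near. Qed.

Definition clip (s : R) : R := Num.max (- sin 1) (Num.min (sin 1) s).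

Lemma sin1_bounds : 0 < sin (1 : R) < 1.
Proof.
have s1 : 0 < sin 1 :> R by apply: sin2_gt0; rewrite ltr01 ltr1n.
have c1 := @cos1_gt0 R; have := cos2Dsin2 (1 : R).
move=> H; rewrite s1/=; nra.
Qed.

Lemma clip_bounds s : - sin 1 <= clip s <= sin 1.
Proof.
have /andP[s0 s1] := sin1_bounds.
rewrite /clip le_max lexx/= ge_max ge_min lexx andbT; lra.
Qed.

Lemma clip_lipschitz s s' : `|clip s - clip s'| <= `|s - s'|.
Proof.
have /andP[s0 s1] := sin1_bounds.
wlog ss' : s s' / s <= s'.
  by move=> H; have [/H //|/ltW/H] := leP s s'; rewrite distrC (distrC s').
rewrite distrC (distrC s) (ger0_norm (_ : 0 <= s' - s)) ?subr_ge0//.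
rewrite /clip /Num.max /Num.min.
repeat (case: ifP => /negP/negP); rewrite -?leNgt -?ltNge; move=> *;
  rewrite ler_norml; lra.
Qed.

Lemma clip_id s : - sin 1 <= s <= sin 1 -> clip s = s.
Proof. by case/andP=> a b; rewrite /clip min_r// max_r. Qed.

Let pihalf1 : 1 <= pi / 2 :> R := @pihalf_ge1 R.

Lemma ler_sin : {in `[(- (pi / 2) : R), pi / 2] &, {mono sin : x y / x <= y}}.
Proof. by move=> x y xi yi; rewrite !leNgt ltr_sin. Qed.

Lemma asin_clip_bounds s : -1 <= asin (clip s) <= 1.
Proof.
have /andP[s0 s1] := sin1_bounds.
have /andP[c1 c2] := clip_bounds s.
have c11 : -1 <= clip s <= 1 by apply/andP; split; lra.
have p1 := pihalf1.
have ai : asin (clip s) \in `[(- (pi / 2)), (pi / 2)].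
  by rewrite in_itv/= asin_geNpi2// asin_lepi2.
have i1 : 1 \in `[(- (pi / 2) : R), (pi / 2)] by rewrite in_itv/=; apply/andP; split; lra.
have iN1 : -1 \in `[(- (pi / 2) : R), (pi / 2)] by rewrite in_itv/=; apply/andP; split; lra.
have ls := ler_sin.
rewrite -(ls _ _ iN1 ai) -(ls _ _ ai i1) sinN asinK; first by rewrite c1 c2.
by rewrite in_itv/=.
Qed.

(** The derivative of sine is at least cos 1 on [-1, 1]. *)
Lemma sin_expand (x y : R) : -1 <= x <= 1 -> -1 <= y <= 1 ->
  cos 1 * `|x - y| <= `|sin x - sin y|.
Proof.
wlog xy : x y / x <= y.
  by move=> H a b; have [/H/(_ a b)//|/ltW/H/(_ b a)] := leP x y; rewrite distrC (distrC (sin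
      y)).
move=> /andP[x1 x2] /andP[y1 y2].
have csin := @continuous_sin R.
have dsin (z : R) (_ : z \in `]x, y[) : is_derive z 1 sin (cos z) by exact: is_derive_sin.
have [c] := MVT_segment xy dsin (continuous_subspaceT csin).
rewrite in_itv/= => /andP[xc cy].
rewrite distrC (distrC (sin x)) => ->; rewrite normrM ler_wpM2r//.
suff : cos 1 <= cos c by move/le_trans; apply; exact: ler_norm.
have p1 := pihalf1.
have nc1 : `|c| <= 1 by rewrite ler_norml; apply/andP; split; lra.
have ci : `|c| \in `[0, pi] by rewrite in_itv/= normr_ge0; lra.
have i1 : (1 : R) \in `[0, pi] by rewrite in_itv/= ler01; lra.
by rewrite -(cos_norm c) leNgt (ltr_cos i1 ci) -leNgt.
Qed.

Lemma asin_clip_lipschitz s s' :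
  `|asin (clip s) - asin (clip s')| <= `|s - s'| / cos 1.
Proof.
have c1 := @cos1_gt0 R; have /andP[s0 s1] := sin1_bounds.
rewrite ler_pdivlMr// mulrC (le_trans (sin_expand (asin_clip_bounds s) (asin_clip_bounds
    s')))//.
have cl u : clip u \in `[(-1), 1].
  by have /andP[c2 c3] := clip_bounds u; rewrite in_itv/=; apply/andP; split; lra.
by rewrite !asinK// clip_lipschitz.
Qed.

Lemma asin_clip_sin x : -1 <= x <= 1 -> asin (clip (sin x)) = x.
Proof.
move=> /andP[x1 x2]; have p1 := pihalf1.
have xi : x \in `[(- (pi / 2)), (pi / 2)] by rewrite in_itv/=; apply/andP; split; lra.
have i1 : 1 \in `[(- (pi / 2) : R), (pi / 2)] by rewrite in_itv/=; apply/andP; split; lra.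
have iN1 : -1 \in `[(- (pi / 2) : R), (pi / 2)] by rewrite in_itv/=; apply/andP; split; lra.
have ls := ler_sin.
by rewrite clip_id ?sinK// -sinN (ls _ _ iN1 xi) (ls _ _ xi i1) x1 x2.
Qed.

End approximation.

Section trig_approximation.
Context {R : realType} {m : nat}.

Lemma rV_norm_lt (v : 'rV[R]_m) (d : R) : 0 < d ->
  (forall i, `|v ord0 i| < d) -> `|v| < d.
Proof.
move=> d0 vd; rewrite /Num.norm /= mx_normrE; apply/bigmax_ltP; split => //= -[i j] _ /=.
by rewrite ord1.
Qed.

(** Real coordinates are turned into points of the unit cube. Periodicity of the
    sine keeps a polynomial in these coordinates bounded on the whole space, by the
    same bound as on the cube, and K fixes the scale on which the map is injective. *)
Definition sine_coords (K : R) (x : 'rV[R]_m) : seq R :=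
  [seq s x | s <- [seq (fun y : 'rV[R]_m => (1 + sin (K^-1 * y ord0 i)) / 2)
                  | i <- enum 'I_m]].

Lemma size_sine_coords K x : size (sine_coords K x) = m.
Proof. by rewrite size_map size_map size_enum_ord. Qed.

Lemma nth_sine_coords K x (i : 'I_m) :
  nth 0 (sine_coords K x) i = (1 + sin (K^-1 * x ord0 i)) / 2.
Proof.
rewrite /sine_coords -map_comp (nth_map i) ?size_enum_ord//=.
by rewrite nth_ord_enum.
Qed.

Lemma sine_coords01 K x : {in sine_coords K x, forall s, 0 <= s <= 1}.
Proof.
move=> s; rewrite /sine_coords -map_comp => /mapP[i _ ->] /=.
have := sin_geN1 (K^-1 * x ord0 i); have := sin_le1 (K^-1 * x ord0 i).
by move=> a b; apply/andP; split; lra.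
Qed.

(** A left inverse of the sine coordinate on [-K, K], extended by clipping to a
    Lipschitz function on the line. *)
Definition unfold_coord (K s : R) : R := K * asin (clip (2 * s - 1)).

(** Inside the box |x_i| <= K, f is a continuous function of the sine coordinates,
    close to its Bernstein polynomial: nodes near the point are handled by uniform
    continuity, distant ones by the variance bound. Outside the box the polynomial
    keeps the bound G of |f|, and K = 2 G / e makes e |x_i| exceed 2 G. *)
Theorem trig_approx (f : 'rV[R]_m -> R) (F e : R) :
    continuous f -> (forall x, `|f x| <= F) -> 0 < e ->
  exists2 T, trig_poly T & forall x, `|f x - T x| <= e * (1 + \sum_i `|x ord0 i|).
Proof.
move=> cf fF' e0; pose G := F + 1.
have fF x : `|f x| <= G by rewrite (le_trans (fF' x))// lerDl.
have G0 : 0 < G.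
  by rewrite ltr_pwDr// (le_trans _ (fF' 0)).
have c1 := @cos1_gt0 R.
(* K is kept opaque, so that arithmetic on it never unfolds its value. *)
have [K KE] : exists K : R, K = 2 * G / e by exists (2 * G / e).
have K0 : 0 < K by rewrite KE divr_gt0// mulr_gt0.
pose box := [set v : 'rV[R]_m | forall i, v ord0 i \in `[(- K), K]].
have cbox : compact box.
  by apply: (@rV_compact _ _ (fun=> `[(- K), K]%classic)) => i; exact: segment_compact.
have e20 : 0 < e / 2 by rewrite divr_gt0.
have [d d0 fd] := compact_uniformly_continuous cbox cf e20.
pose v (ks : nat -> R) : 'rV[R]_m := \row_i unfold_coord K (ks i).
have vbox u : box (v u).
  move=> i; rewrite mxE in_itv/= /unfold_coord.
  by have /andP[a b] := asin_clip_bounds (2 * u i - 1); apply/andP; split; nra.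
have [d' d'E] : exists d' : R, d' = d * cos 1 / (4 * K) by eexists.
have d'0 : 0 < d' by rewrite d'E divr_gt0// mulr_gt0.
have vd (u u' : nat -> R) : (forall i : 'I_m, `|u i - u' i| < d') -> `|f (v u) - f (v u')| <=
    e / 2.
  move=> uu'; apply: fd => //; apply: rV_norm_lt => // i; rewrite !mxE /unfold_coord.
  rewrite -mulrBr normrM (gtr0_norm K0).
  rewrite (le_lt_trans (ler_wpM2l (ltW K0) (asin_clip_lipschitz _ _)))//.
  have -> : 2 * u i - 1 - (2 * u' i - 1) = 2 * (u i - u' i) by ring.
  rewrite normrM ger0_norm// mulrA ltr_pdivrMr//.
  have := uu' i; rewrite d'E ltr_pdivlMr ?mulr_gt0// => H.
  have := normr_ge0 (u i - u' i); nra.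
have [C CE] : exists C : R, C = 2 * G / d' ^+ 2 by eexists.
have C0 : 0 < C by rewrite CE divr_gt0 ?exprn_gt0 ?mulr_gt0.
pose N := (Num.trunc (2 * m%:R * C / e)).+1.
have N0 : 0 < N%:R :> R by rewrite ltr0n.
have NC : m%:R * C / N%:R <= e / 2.
  have := Num.Theory.truncnS_gt (2 * m%:R * C / e); rewrite -/N => /ltW.
  by rewrite ler_pdivrMr// ler_pdivrMr// => H; rewrite mulrAC; lra.
pose h ks := f (v (fun i => (nth 0%N ks i)%:R / N%:R)).
pose T x := bernstein_seq N (sine_coords K x) h.
exists T.
  apply: trig_bernstein_seq => i; rewrite size_map size_enum_ord => im.
  rewrite (nth_map (Ordinal im)) ?size_enum_ord//.
  exact: trig_sin.
move=> x; have x01 := @sine_coords01 K x.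
have cst_bern c : bernstein_seq N (sine_coords K x) (fun=> c) = c.
  rewrite (_ : (fun=> c) = (fun ks : seq nat => 0 * (fun=> 0 : R) ks + c)); last first.
    by apply/funext => ks; rewrite mul0r add0r.
  by rewrite bernstein_seq_affine mul0r add0r.
have TG : `|T x| <= G.
  rewrite ler_norml; apply/andP; split.
    rewrite -[leLHS]cst_bern; apply: bernstein_seq_le => // ks _.
    by have := fF (v (fun i => (nth 0%N ks i)%:R / N%:R)); rewrite ler_norml => /andP[].
  rewrite -[leRHS]cst_bern; apply: bernstein_seq_le => // ks _.
  by have := fF (v (fun i => (nth 0%N ks i)%:R / N%:R)); rewrite ler_norml => /andP[].
have [xbox|/existsNP[i xi]] := pselect (box x); last first.
  have {xi} Kx : K < `|x ord0 i|.
    by rewrite ltNge; apply/negP => H; apply: xi; rewrite in_itv/= -ler_norml.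
  rewrite (le_trans (ler_normB _ _))// (le_trans (lerD (fF x) TG))//.
  have -> : G + G = e * K by rewrite KE; field; rewrite gt_eqF.
  rewrite ler_wpM2l ?(ltW e0)// (bigD1 i)//= (le_trans (ltW Kx))//.
  rewrite addrCA lerDl addr_ge0// sumr_ge0//.
suff : `|f x - T x| <= e.
  by move/le_trans; apply; rewrite ler_peMr ?(ltW e0)// lerDl sumr_ge0.
have fx : f x = f (v (fun i => nth 0 (sine_coords K x) i)).
  congr f; apply/rowP => i; rewrite mxE nth_sine_coords /unfold_coord.
  have -> : 2 * ((1 + sin (K^-1 * x ord0 i)) / 2) - 1 = sin (K^-1 * x ord0 i) by field.
  rewrite asin_clip_sin ?mulVKf ?gt_eqF//; have := xbox i; rewrite in_itv/= => /andP[a b].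
  by rewrite mulrC ler_pdivlMr// ler_pdivrMr// mul1r mulN1r a b.
have [q qE] : exists q : R, q = C / N%:R ^+ 2 by eexists.
have q0 : 0 < q by rewrite qE divr_gt0 ?exprn_gt0.
have key ks : size ks = size (sine_coords K x) ->
    `|f x - h ks| <= e / 2 + q * deviation N (sine_coords K x) ks.
  move=> sks.
  have [H|/existsNP[i /negP]] := pselect (forall i : 'I_m,
      `|nth 0 (sine_coords K x) i - (nth 0%N ks i)%:R / N%:R| < d').
    rewrite fx (le_trans (vd _ _ H))// lerDl mulr_ge0 ?(ltW q0)// deviation_ge0//.
  rewrite -leNgt => Hi.
  have im : (i < size (sine_coords K x))%N by rewrite size_sine_coords.
  have := deviation_ge N sks im.
  set a := nth 0 _ _ in Hi *; set k := (nth 0%N ks i)%:R in Hi *; set D := deviation _ _ _ =>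
      dev.
  rewrite (le_trans (ler_normB _ _))// (le_trans (lerD (fF x) (fF _)))//.
  have -> : G + G = C * d' ^+ 2 by rewrite CE; field; rewrite gt_eqF.
  rewrite (@le_trans _ _ (q * D))// ?lerDr ?(ltW e20)//.
  rewrite qE mulrAC ler_pdivlMr ?exprn_gt0// -mulrA ler_wpM2l ?(ltW C0)//.
  rewrite (le_trans _ dev)// -exprMn -[leRHS]real_normK ?num_real// lerXn2r ?nnegrE//.
    by rewrite mulr_ge0// ltW.
  have -> : k - N%:R * a = - (N%:R * (a - k / N%:R)) by field; rewrite gt_eqF.
  by rewrite normrN normrM mulrC gtr0_norm// ler_wpM2l// ltW.
have dev := bernstein_seq_deviation N x01.
have qm : q * bernstein_seq N (sine_coords K x) (deviation N (sine_coords K x)) <= e / 2.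
  rewrite (le_trans (ler_wpM2l (ltW q0) dev))// (le_trans _ NC)// size_sine_coords.
  by rewrite qE le_eqVlt; apply/orP; left; apply/eqP; field; rewrite gt_eqF.
rewrite distrC ler_norml; apply/andP; split.
  rewrite lerBrDr addrC.
  rewrite (@le_trans _ _ (bernstein_seq N (sine_coords K x) (fun ks => - q * deviation N
      (sine_coords K x) ks + (f x - e / 2))))//.
    rewrite bernstein_seq_affine mulNr; lra.
  by apply: bernstein_seq_le => // ks sks; have := key _ sks; rewrite ler_norml => /andP[]; lra.
rewrite lerBlDr.
rewrite (@le_trans _ _ (bernstein_seq N (sine_coords K x) (fun ks => q * deviation N
    (sine_coords K x) ks + (f x + e / 2))))//.
  by apply: bernstein_seq_le => // ks sks; have := key _ sks; rewrite ler_norml => /andP[]; lra.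
rewrite bernstein_seq_affine; lra.
Qed.

End trig_approximation.

(** * Convergence in distribution from cosine moments *)

Section expectation_tools.
Context (d : measure_display) (T : measurableType d) (R : realType).
Context (P : probability T R).
Implicit Types f g : T -> R.

Local Notation integrable f := (P.-integrable setT (EFin \o f)).

Lemma bounded_integrable f (M : R) : measurable_fun setT f ->
  (forall w, `|f w| <= M) -> integrable f.
Proof.
move=> mf fM; apply: (@measurable_bounded_integrable _ _ _ P) => //.
  by rewrite (le_lt_trans (probability_le1 P measurableT)) ?ltry.
exists M; split; first exact: num_real.
by move=> r Mr w _; exact: le_trans (fM w) (ltW Mr).
Qed.

Lemma integrable_expectationE f : integrable f -> 'E_P[f]%E = (\int[P]_w f w)%:E.
Proof.
by move=> fi; rewrite unlock /Rintegral fineK//; exact: integrable_fin_num.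
Qed.

Lemma integrable_addr f g : integrable f -> integrable g -> integrable (fun w => f w + g w).
Proof.
move=> fi gi; rewrite (_ : _ \o _ = fun w => ((f w)%:E + (g w)%:E)%E)//.
exact: integrableD.
Qed.

Lemma integrable_subr f g : integrable f -> integrable g -> integrable (fun w => f w - g w).
Proof.
move=> fi gi; rewrite (_ : _ \o _ = fun w => ((f w)%:E - (g w)%:E)%E)//.
exact: integrableB.
Qed.

Lemma integrable_mulrl f (a : R) : integrable f -> integrable (fun w => a * f w).
Proof.
move=> fi; rewrite (_ : _ \o _ = fun w => (a%:E * (f w)%:E)%E)//.
exact: integrableZl.
Qed.

Lemma integrable_cst (a : R) : integrable (fun=> a).
Proof. exact: finite_measure_integrable_cst. Qed.

Lemma Rintegral_prob_cst (a : R) : \int[P]_w a = a.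
Proof. by rewrite Rintegral_cst//= probability_setT mulr1. Qed.

Lemma integrable_sumr (I : Type) (s : seq I) (F : I -> T -> R) :
  (forall i, integrable (F i)) -> integrable (fun w => \sum_(i <- s) F i w).
Proof.
move=> Fi; elim: s => [|i s IH].
  by under eq_fun do rewrite big_nil; exact: integrable_cst.
by under eq_fun do rewrite big_cons; exact: integrable_addr.
Qed.

Lemma Rintegral_sumr (I : Type) (s : seq I) (F : I -> T -> R) :
  (forall i, integrable (F i)) ->
  \int[P]_w (\sum_(i <- s) F i w) = \sum_(i <- s) \int[P]_w F i w.
Proof.
move=> Fi; elim: s => [|i s IH].
  by under eq_Rintegral do rewrite big_nil; rewrite Rintegral_prob_cst big_nil.
under eq_Rintegral do rewrite big_cons.
by rewrite RintegralD//; [rewrite IH big_cons|exact: integrable_sumr].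
Qed.

End expectation_tools.

Section trig_random_vector.
Context (d : measure_display) (T : measurableType d) (R : realType).
Context (P : probability T R) (m : nat) (X : 'I_m -> {RV P >-> R}).

Definition random_row (w : T) : 'rV[R]_m := \row_i X i w.

Lemma trig_poly_bounded (f : 'rV[R]_m -> R) : trig_poly f ->
  exists M, forall x, `|f x| <= M.
Proof.
elim=> [c a th|g h _ [M gM] _ [N hN]].
  by exists `|c| => x; rewrite normrM ler_piMr// cos_max.
by exists (M + N) => x; rewrite (le_trans (ler_normD _ _))// lerD.
Qed.

Lemma dot_random_row a w : dot a (random_row w) = \sum_i a i * X i w.
Proof. by apply: eq_bigr => i _; rewrite mxE. Qed.

Lemma measurable_trig_poly (f : 'rV[R]_m -> R) : trig_poly f ->
  measurable_fun setT (f \o random_row).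
Proof.
elim=> [c a th|g h _ mg _ mh]; last exact: measurable_funD.
apply: measurable_funM => //.
apply: (@measurableT_comp _ _ _ _ _ _ cos).
  apply: continuous_measurable_fun; exact: continuous_cos.
apply: measurable_funD => //.
under eq_fun do rewrite dot_random_row.
by apply: measurable_sum => i; exact: measurable_funM.
Qed.

Lemma integrable_trig_poly (f : 'rV[R]_m -> R) : trig_poly f ->
  P.-integrable setT (EFin \o (f \o random_row)).
Proof.
move=> tf; have [M fM] := trig_poly_bounded tf.
exact: bounded_integrable (measurable_trig_poly tf) (fun w => fM _).
Qed.

(** Trigonometric approximation exhibits f composed with the vector as a pointwise
    limit of measurable functions; no sigma-algebra on row vectors is involved. *)
Lemma measurable_continuous_row (f : 'rV[R]_m -> R) (F : R) : continuous f ->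
  (forall x, `|f x| <= F) -> measurable_fun setT (f \o random_row).
Proof.
move=> cf fF.
have h n : {g | trig_poly g /\
    forall x, `|f x - g x| <= harmonic n * (1 + \sum_i `|x ord0 i|)}.
  by apply/cid; have [g tg fg] := trig_approx cf fF (harmonic_gt0 n); exists g.
apply: (@measurable_fun_cvg _ _ _ _ (fun n => sval (h n) \o random_row)).
  by move=> n; case: (h n) => g [tg _] /=; exact: measurable_trig_poly.
move=> w _ /=; apply/cvgrPdist_le => e e0.
set S := 1 + \sum_i `|random_row w ord0 i|.
have S0 : 0 < S by rewrite ltr_pwDl// sumr_ge0.
have : harmonic n * S @[n --> \oo] --> (0 : R).
  by rewrite -(mul0r S); apply: cvgM; [exact: cvg_harmonic|exact: cvg_cst].
move=> /cvgrPdist_le /(_ _ e0); apply: filterS => n.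
rewrite sub0r normrN ger0_norm ?mulr_ge0 ?(ltW S0) ?harmonic_ge0// => nS.
by case: (h n) => g [_ fg] /=; rewrite (le_trans (fg _)).
Qed.

Lemma trig_approx_expectation (f g : 'rV[R]_m -> R) (F e C : R) : continuous f ->
    (forall x, `|f x| <= F) -> trig_poly g -> 0 < e ->
    (forall x, `|f x - g x| <= e * (1 + \sum_i `|x ord0 i|)) ->
    (forall i, P.-integrable setT (EFin \o X i)) ->
    (forall i, \int[P]_w `|X i w| <= C) ->
  `|\int[P]_w f (random_row w) - \int[P]_w g (random_row w)| <= e * (1 + m%:R * C).
Proof.
move=> cf fF tg e0 fg iX XC.
have if_ : P.-integrable setT (EFin \o (f \o random_row)).
  exact: bounded_integrable (measurable_continuous_row cf fF) (fun w => fF _).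
have ig := integrable_trig_poly tg.
have iaX i : P.-integrable setT (EFin \o (fun w => `|X i w|)).
  exact: integrable_norm.
rewrite -RintegralB//.
have ifg := integrable_subr if_ ig.
rewrite (le_trans (le_normr_Rintegral _ ifg))//.
rewrite (@le_trans _ _ (\int[P]_w (e * (1 + \sum_i `|X i w|))))//.
  apply: le_Rintegral => //.
  - exact: integrable_norm.
  - apply: integrable_mulrl; apply: integrable_addr; first exact: integrable_cst.
    exact: integrable_sumr.
  - move=> w _; rewrite (le_trans (fg _))// ler_wpM2l ?(ltW e0)// lerD2l.
    by apply: ler_sum => i _; rewrite mxE.
rewrite RintegralZl//; last first.
  apply: integrable_addr; [exact: integrable_cst|exact: integrable_sumr].
rewrite ler_wpM2l ?(ltW e0)// RintegralD//; last 2 first.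
- exact: integrable_cst.
- exact: integrable_sumr.
rewrite Rintegral_prob_cst lerD2l Rintegral_sumr//.
rewrite (le_trans (ler_sum _ (fun i _ => XC i)))//.
by rewrite sumr_const card_ord mulr_natl.
Qed.

End trig_random_vector.

(** Bounded first moments replace tightness, through the weight 1 + sum |x_i| in the
    approximation by trigonometric polynomials. *)
Theorem cvg_in_distribution_cos (R : realType)
    (d : measure_display) (T : measurableType d) (P : probability T R)
    (d' : measure_display) (T' : measurableType d') (P' : probability T' R)
    (m : nat) (X : nat -> 'I_m -> {RV P >-> R}) (Y : 'I_m -> {RV P' >-> R}) (C : R) :
    (forall a th, \int[P]_w cos (\sum_i a i * X n i w + th) @[n --> \oo] -->
                  \int[P']_w cos (\sum_i a i * Y i w + th)) ->
    (\forall n \near \oo, forall i, P.-integrable setT (EFin \o X n i) /\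
       \int[P]_w `|X n i w| <= C) ->
    (forall i, P'.-integrable setT (EFin \o Y i) /\ \int[P']_w `|Y i w| <= C) ->
  cvg_in_distribution P P' X Y.
Proof.
move=> Xcos XC YC f cf [F0 [_ /(_ (F0 + 1))]]; rewrite ltrDl ltr01 => /(_ isT) fF0.
have {fF0} fF x : `|f x| <= F0 + 1 by exact: fF0.
have trigcvg g : trig_poly g -> \int[P]_w g (random_row (X n) w) @[n --> \oo] -->
    \int[P']_w g (random_row Y w).
  elim=> [c a th|g1 g2 tg1 IH1 tg2 IH2].
    have waveE d0 (T0 : measurableType d0) (P0 : probability T0 R) (Z : 'I_m -> {RV P0 >-> R}) :
        \int[P0]_w (c * cos (dot a (random_row Z w) + th)) =
        c * \int[P0]_w cos (\sum_i a i * Z i w + th).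
      under eq_Rintegral do rewrite dot_random_row.
      rewrite RintegralZl//.
      have := integrable_trig_poly Z (trig_wave 1 a th).
      by congr (integrable _ _ _); apply/funext => w /=; rewrite mul1r dot_random_row.
    under eq_fun do rewrite waveE; rewrite waveE.
    by apply: cvgM; [exact: cvg_cst|exact: Xcos].
  have addE d0 (T0 : measurableType d0) (P0 : probability T0 R) (Z : 'I_m -> {RV P0 >-> R}) :
      \int[P0]_w (g1 (random_row Z w) + g2 (random_row Z w)) =
      \int[P0]_w g1 (random_row Z w) + \int[P0]_w g2 (random_row Z w).
    by rewrite RintegralD//; exact: (integrable_trig_poly Z).
  by under eq_fun do rewrite addE; rewrite addE; exact: cvgD.
have ifX n := bounded_integrable P (measurable_continuous_row (X n) cf fF) (fun w => fF _).
have ifY := bounded_integrable P' (measurable_continuous_row Y cf fF) (fun w => fF _).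
under eq_fun do rewrite (integrable_expectationE (ifX _)).
rewrite (integrable_expectationE ifY).
apply: cvg_EFin; first exact: nearW.
apply/cvgrPdist_le => e e0.
pose D := 1 + m%:R * `|C|.
have D0 : 0 < D by rewrite ltr_pwDl// mulr_ge0.
pose e' := e / (3 * D).
have e'0 : 0 < e' by rewrite divr_gt0// mulr_gt0.
have [g tg fg] := trig_approx cf fF e'0.
have e30 : 0 < e / 3 by rewrite divr_gt0.
have /cvgrPdist_le/(_ _ e30) Hg := trigcvg _ tg.
have DC : e' * (1 + m%:R * C) <= e / 3.
  have -> : e / 3 = e' * D by rewrite /e'; field; rewrite gt_eqF.
  by rewrite ler_wpM2l ?(ltW e'0)// lerD2l ler_wpM2l// ler_norm.
have Yfg := trig_approx_expectation cf fF tg e'0 fg (fun i => (YC i).1) (fun i => (YC i).2).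
near=> n.
have XCn : forall i, P.-integrable setT (EFin \o X n i) /\ \int[P]_w `|X n i w| <= C.
  by near: n.
have Xfg := trig_approx_expectation cf fF tg e'0 fg (fun i => (XCn i).1) (fun i => (XCn i).2).
have gn : `|\int[P']_w g (random_row Y w) - \int[P]_w g (random_row (X n) w)| <= e / 3.
  by near: n.
move: Xfg Yfg gn; rewrite /= -/(random_row _ _).
set a := \int[P]_w f _; set b := \int[P']_w f _; set a' := \int[P]_w g _; set b' := \int[P']_w
    g _.
rewrite !ler_norml => /andP[? ?] /andP[? ?] /andP[? ?]; apply/andP; split; lra.
Unshelve. all: by end_near. Qed.

(** * Weighted sums of independent indicators *)

Section bernoulli_average.
Context {R : realType}.
Implicit Types (p b x : R) (f : R -> R).

(** The mean of f(x + b (Y - p)) for a Bernoulli variable Y of parameter p. *)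
Definition bernoulli_average p b f x : R :=
  p * f (x + b * (1 - p)) + (1 - p) * f (x - b * p).

Lemma bernoulli_average_dist p b f g x (M : R) : 0 <= p <= 1 ->
  (forall y, `|f y - g y| <= M) ->
  `|bernoulli_average p b f x - bernoulli_average p b g x| <= M.
Proof.
move=> /andP[p0 p1] fgM; rewrite /bernoulli_average.
have := fgM (x + b * (1 - p)); have := fgM (x - b * p).
set u1 := f _; set u2 := g _; set u3 := f _; set u4 := g _.
rewrite !ler_norml => /andP[a1 a2] /andP[a3 a4]; apply/andP; split; nra.
Qed.

(** The increment b (Y - p) is centred with variance b^2 p (1 - p), so the second
    order expansion multiplies the wave by 1 - b^2 p (1 - p) / 2; replacing p (1 - p)
    by p costs b^2 p^2 / 2. *)
Lemma bernoulli_average_cos p b x : 0 <= p <= 1 -> `|b| <= 1 ->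
  `|bernoulli_average p b cos x - expR (- (b ^+ 2 * p / 2)) * cos x|
    <= 2 * `|b| ^+ 3 * p + b ^+ 2 * p ^+ 2.
Proof.
move=> /andP[p0 p1] b1; rewrite /bernoulli_average.
pose y1 := b * (1 - p); pose y2 := - (b * p).
have y1b : `|y1| = `|b| * (1 - p) by rewrite normrM [X in _ * X]ger0_norm// subr_ge0.
have y2b : `|y2| = `|b| * p by rewrite normrN normrM (ger0_norm p0).
have b0 := normr_ge0 b.
have y11 : `|y1| <= 1 by rewrite y1b mulr_ile1// ?subr_ge0//; lra.
have y21 : `|y2| <= 1 by rewrite y2b mulr_ile1.
have := cos_increment2 x y11; have := cos_increment2 x y21.
rewrite y1b y2b; set r2 := cos _ - _ + _; set r1 := cos _ - _ + _ => H2 H1.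
have e2 : 0 <= b ^+ 2 * p / 2 by rewrite divr_ge0// mulr_ge0// sqr_ge0.
have := expRN_increment e2; set r3 := _ - _ => H3.
have -> : p * cos (x + b * (1 - p)) + (1 - p) * cos (x - b * p) -
    expR (- (b ^+ 2 * p / 2)) * cos x =
    (p * r1 + (1 - p) * r2) + (b ^+ 2 * p ^+ 2 / 2 - r3) * cos x.
  by rewrite /r1 /r2 /r3 /y1 /y2; field.
rewrite (le_trans (ler_normD _ _))//; apply: lerD.
  rewrite (le_trans (ler_normD _ _))// !normrM (ger0_norm p0).
  rewrite (ger0_norm (_ : 0 <= 1 - p)) ?subr_ge0//.
  have h1 : p * `|r1| <= p * (2 * (`|b| * (1 - p)) ^+ 3) by rewrite ler_wpM2l.
  have h2 : (1 - p) * `|r2| <= (1 - p) * (2 * (`|b| * p) ^+ 3) by rewrite ler_wpM2l ?subr_ge0.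
  rewrite (le_trans (lerD h1 h2))//.
  have -> : p * (2 * (`|b| * (1 - p)) ^+ 3) + (1 - p) * (2 * (`|b| * p) ^+ 3) =
    (2 * `|b| ^+ 3) * (p * ((1 - p) ^+ 3 + (1 - p) * p ^+ 2)) by ring.
  rewrite ler_wpM2l ?mulr_ge0 ?exprn_ge0// ler_piMr//.
  have := sqr_ge0 p; have : 0 <= p * (1 - p) by rewrite mulr_ge0// subr_ge0.
  move=> q0 s0; have -> : (1 - p) ^+ 3 + (1 - p) * p ^+ 2 = (1 - p) * (1 - 2 * (p * (1 - p)))
      by ring.
  by rewrite mulr_ile1 ?subr_ge0//; nra.
rewrite normrM (le_trans (ler_piMr _ (cos_max _)))//.
rewrite (le_trans (ler_normB _ _))// ger0_norm; last first.
  by rewrite divr_ge0// mulr_ge0// sqr_ge0.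
rewrite (le_trans (lerD (lexx _) H3))//.
have bb : b ^+ 2 <= 1 by rewrite -real_normK ?num_real// expr_le1.
have : 0 <= b ^+ 2 * p ^+ 2 by rewrite mulr_ge0// sqr_ge0.
have -> : (b ^+ 2 * p / 2) ^+ 2 = (b ^+ 2 * p ^+ 2) * (b ^+ 2 / 4) by field.
by move=> H; nra.
Qed.

End bernoulli_average.

Section independent_events.
Context (d : measure_display) (T : measurableType d) (R : realType).
Context (P : probability T R) (I : eqType) (E : I -> set T) (b : I -> R).
Hypothesis mE : forall i, measurable (E i).

Let p i : R := fine (P (E i)).

Definition independent_events (L : seq I) : Prop :=
  forall J : seq I, uniq J -> {subset J <= L} ->
    (P (\bigcap_(j in [set` J]) E j) = \prod_(j <- J) P (E j))%E.

Definition centered_sum (L : seq I) (w : T) : R :=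
  \sum_(i <- L) b i * (\1_(E i) w - p i).

Fixpoint average_over (L : seq I) (f : R -> R) : R -> R :=
  if L is i :: L' then bernoulli_average (p i) (b i) (average_over L' f) else f.

Let p01 i : 0 <= p i <= 1.
Proof. by rewrite /p fine_ge0//= -lee_fin fineK ?fin_num_measure// probability_le1. Qed.

Let cap (J : seq I) : set T := \bigcap_(j in [set` J]) E j.

Let mcap J : measurable (cap J).
Proof. by apply: fin_bigcap_measurable => // i _; exact: mE. Qed.

Let cap_cons i J : cap (i :: J) = E i `&` cap J.
Proof.
rewrite /cap -bigcap_setU1; congr bigcap; apply/seteqP; split => j /=.
  by rewrite inE => /orP[/eqP ->|jJ]; [left|right].
by rewrite inE => -[->|->]; rewrite ?eqxx ?orbT.
Qed.

(** Induction on L, splitting on the event of its head. The events already met are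
    remembered in J, since the induction needs the integral over their intersection;
    expressing the complement by a difference keeps only intersections. *)
Lemma integral_centered_sum (L J : seq I) (f : R -> R) (x : R) :
    independent_events (J ++ L) -> uniq (J ++ L) ->
  P.-integrable setT (EFin \o (fun w => \1_(cap J) w * f (x + centered_sum L w))) /\
  \int[P]_w (\1_(cap J) w * f (x + centered_sum L w)) =
  fine (P (cap J)) * average_over L f x.
Proof.
elim: L J x => [|i L IH] J x indep uJL.
  have -> : (fun w => \1_(cap J) w * f (x + centered_sum [::] w)) =
      (fun w => f x * \1_(cap J) w).
    by apply/funext => w; rewrite /centered_sum big_nil addr0 mulrC.
  have i1 : P.-integrable setT (EFin \o \1_(cap J)).
    apply: (@bounded_integrable _ _ _ P _ 1) => // w.
    by rewrite indicE ger0_norm ?ler0n// lern1 leq_b1.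
  split; first exact: integrable_mulrl.
  rewrite RintegralZl// mulrC; congr (_ * _).
  by rewrite /Rintegral integral_indic// setIT.
(* The indicator of the event i moves the intersection from J to i :: J. *)
have perm : perm_eq ((i :: J) ++ L) (J ++ i :: L) by rewrite -(cat1s i J) -catA perm_catCA.
have uiJL : uniq ((i :: J) ++ L) by rewrite (perm_uniq perm).
have indep1 : independent_events ((i :: J) ++ L).
  move=> K uK KL; apply: indep => // j jK.
  by rewrite -(perm_mem perm); exact: KL.
have uJL' : uniq (J ++ L).
  by move: uiJL; rewrite cat_cons /= => /andP[].
have indep2 : independent_events (J ++ L).
  by move=> K uK KL; apply: indep1 => // j jK; rewrite inE KL ?orbT.
have [ia Ea] := IH (i :: J) (x + b i * (1 - p i)) indep1 uiJL.
have [ib Eb] := IH J (x - b i * p i) indep2 uJL'.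
have [ic Ec] := IH (i :: J) (x - b i * p i) indep1 uiJL.
have -> : (fun w => \1_(cap J) w * f (x + centered_sum (i :: L) w)) =
  (fun w => (\1_(cap (i :: J)) w * f (x + b i * (1 - p i) + centered_sum L w) +
            \1_(cap J) w * f (x - b i * p i + centered_sum L w)) -
            \1_(cap (i :: J)) w * f (x - b i * p i + centered_sum L w)).
  apply/funext => w; rewrite /centered_sum big_cons -/(centered_sum L w).
  rewrite cap_cons indicI /= addrA.
  rewrite !(indicE _ (E i)); case: (w \in E i) => /=.
    by rewrite !mul1r addrK.
  by rewrite !mul0r mulr0n sub0r mulrN add0r subr0.
split; first by apply: integrable_subr => //; exact: integrable_addr.
rewrite RintegralB//; last exact: integrable_addr.
rewrite RintegralD// Ea Eb Ec /= /bernoulli_average.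
have -> : fine (P (cap (i :: J))) = p i * fine (P (cap J)).
  move: uiJL; rewrite cat_uniq => /andP[uiJ _]; have := uiJ => /= /andP[_ uJ].
  rewrite /cap indep1//; last by move=> j jJ; rewrite mem_cat jJ.
  rewrite indep2//; last by move=> j jJ; rewrite mem_cat jJ.
  rewrite big_cons fineM ?fin_num_measure//.
  by rewrite prode_fin_num// => j _; rewrite fin_num_measure.
ring.
Qed.

Lemma Rintegral_centered_sum (L : seq I) (f : R -> R) (x : R) :
    independent_events L -> uniq L ->
  P.-integrable setT (EFin \o (fun w => f (x + centered_sum L w))) /\
  \int[P]_w (f (x + centered_sum L w)) = average_over L f x.
Proof.
move=> indep uL.
have cap0 : cap [::] = setT by rewrite /cap classical_sets.set_nil bigcap_set0.
have [] := @integral_centered_sum L [::] f x indep uL.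
rewrite cap0 probability_setT mul1r.
have -> : (fun w => \1_setT w * f (x + centered_sum L w)) = (fun w => f (x + centered_sum L w)).
  by apply/funext => w; rewrite indicT mul1r.
by [].
Qed.

(** Averaging is a contraction for the uniform norm and the factors
    exp(- b^2 p / 2) are at most 1, so that the errors made at each step add up. *)
Lemma average_over_cos (L : seq I) (x : R) :
    (forall i, i \in L -> `|b i| <= 1) ->
  `|average_over L cos x - expR (- (\sum_(i <- L) b i ^+ 2 * p i / 2)) * cos x| <=
  \sum_(i <- L) (2 * `|b i| ^+ 3 * p i + b i ^+ 2 * p i ^+ 2).
Proof.
elim: L x => [|i L IH] x b1 /=.
  by rewrite !big_nil oppr0 expR0 mul1r subrr normr0.
rewrite !big_cons opprD expRD.
set W := expR (- \sum_(_ <- _) _); set w := expR _.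
have W1 : `|W| <= 1.
  rewrite ger0_norm ?expR_ge0// -[leRHS]expR0 ler_expR oppr_le0 sumr_ge0// => j _.
  by have /andP[] := p01 j => p0 _; rewrite divr_ge0// mulr_ge0// sqr_ge0.
have -> : bernoulli_average (p i) (b i) (average_over L cos) x - w * W * cos x =
  (bernoulli_average (p i) (b i) (average_over L cos) x -
   bernoulli_average (p i) (b i) (fun y => W * cos y) x) +
  W * (bernoulli_average (p i) (b i) cos x - w * cos x).
  by rewrite /bernoulli_average; ring.
rewrite (le_trans (ler_normD _ _))// addrC lerD//.
  rewrite normrM (le_trans (ler_piMl _ W1))//; apply: bernoulli_average_cos => //.
  by rewrite b1// mem_head.
apply: bernoulli_average_dist => // y; apply: IH => j jL.
by rewrite b1// inE jL orbT.
Qed.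

Lemma average_over_sqr (L : seq I) (x : R) :
  average_over L (fun y => y ^+ 2) x =
  x ^+ 2 + \sum_(i <- L) b i ^+ 2 * (p i * (1 - p i)).
Proof.
elim: L x => [|i L IH] x /=; first by rewrite big_nil addr0.
by rewrite /bernoulli_average !IH big_cons; ring.
Qed.

Theorem centered_sum_cos (L : seq I) (th : R) :
    independent_events L -> uniq L -> (forall i, i \in L -> `|b i| <= 1) ->
  `|\int[P]_w cos (centered_sum L w + th) -
    expR (- (\sum_(i <- L) b i ^+ 2 * p i / 2)) * cos th| <=
  \sum_(i <- L) (2 * `|b i| ^+ 3 * p i + b i ^+ 2 * p i ^+ 2).
Proof.
move=> indep uL b1; have [_ H] := Rintegral_centered_sum cos th indep uL.
under eq_Rintegral do rewrite addrC.
by rewrite H; exact: average_over_cos.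
Qed.

Lemma centered_sum_sqr (L : seq I) : independent_events L -> uniq L ->
  P.-integrable setT (EFin \o (fun w => centered_sum L w ^+ 2)) /\
  \int[P]_w (centered_sum L w ^+ 2) <= \sum_(i <- L) b i ^+ 2 * p i.
Proof.
move=> indep uL; have [] := Rintegral_centered_sum (fun y => y ^+ 2) 0 indep uL.
rewrite (_ : (fun w => _ ^+ 2) = (fun w => centered_sum L w ^+ 2)); last first.
  by apply/funext => w; rewrite add0r.
move=> ? ->; split => //.
rewrite average_over_sqr expr0n add0r; apply: ler_sum => i _.
have /andP[p0 p1] := p01 i.
by rewrite ler_wpM2l ?sqr_ge0// ler_piMr// gerBl.
Qed.

End independent_events.

(** * Decomposition of the traffic count *)

Section traffic.
Context (d : measure_display) (T : measurableType d) (R : realType).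
Context (P : probability T R) (xi : int -> {RV P >-> R}).

(** Customer j is scheduled at time j and arrives at time j + xi_j. *)
Definition late (s : R) (j : int) : set T := [set w | s < j%:~R + xi j w].

Definition late_count (s : R) (n0 K : nat) (w : T) : R :=
  \sum_(k < K) \1_(late s (n0%:Z - k%:Z)) w.

Definition far_arrivals (s : R) (n0 K : nat) (w : T) : \bar R :=
  (\sum_(i <oo) (\1_(`]0%R, s]%classic) ((- (K + i)%:Z)%:~R + xi (- (K + i)%:Z) w))%:E)%E.

(** Customers scheduled after s are not counted, as xi is positive. The others are
    enumerated backwards from the last schedule n0 before s. *)
Lemma traffic_count_series (s : R) (n0 : nat) (w : T) :
    n0%:R <= s < n0.+1%:R -> (forall j, 0 < xi j w) ->
  traffic_count xi s w =
  (\sum_(k <oo) (\1_(`]0%R, s]%classic) ((n0%:Z - k%:Z)%:~R + xi (n0%:Z - k%:Z) w))%:E)%E.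
Proof.
move=> /andP[n0s sn0] xi0; rewrite /traffic_count.
pose phi (j : int) : \bar R := (\1_(`]0%R, s]%classic) (j%:~R + xi j w))%:E.
have phi0 j : (0 <= phi j)%E by rewrite /phi lee_fin.
rewrite (esumID [set j : int | j <= n0%:Z])//.
rewrite [X in (_ + X)%E]esum1 ?adde0; last first.
  move=> j [_ /= /negP]; rewrite -ltNge => jn0.
  rewrite /phi indicE; case: (boolP (_ \in _)) => //; rewrite inE /= in_itv/= => /andP[_].
  move=> js; exfalso; have : n0.+1%:R <= j%:~R :> R.
    by rewrite -[n0.+1%:R]/(n0.+1%:Z%:~R) ler_int; lia.
  by have := xi0 j; lra.
rewrite setTI nneseries_esumT//.
have -> : [set j : int | j <= n0%:Z] = (fun k : nat => n0%:Z - k%:Z) @` [set: nat].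
  apply/seteqP; split => [j /= jn0|_ [k _ <-]] /=; last by lia.
  exists `|n0%:Z - j|%N => //; lia.
rewrite esum_image//; move=> k l _ _; lia.
Qed.

(** The first sum collects the customers late at s scheduled at least K places before
    s, the second one those that are late both at 0 and at s, and the series those
    scheduled long before 0. Where the series is infinite the bound is trivial,
    which spares a proof that the count is almost surely finite. *)
Lemma traffic_count_decomposition (s : R) (n0 K : nat) (w : T) :
    n0%:R <= s < n0.+1%:R -> (K <= n0)%N -> (forall j, 0 < xi j w) ->
  (`|fine (traffic_count xi s w) - n0%:R - (late_count 0 0 K w - late_count s n0 K w)|%:E
   <= (\sum_(i < n0 - K) \1_(late s (n0%:Z - (K + i)%:Z)) w +
       \sum_(k < K) \1_(late s (- k%:Z)) w)%:E + far_arrivals s n0 K w)%E.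
Proof.
move=> n0s Kn0 xi0; rewrite (traffic_count_series n0s xi0).
have /andP[n0s1 n0s2] := n0s.
set phi := fun k : nat => (\1_(`]0%R, s]%classic) ((n0%:Z - k%:Z)%:~R + xi (n0%:Z - k%:Z) w) :
    R).
rewrite (nneseries_split 0 (n0 + K))//= add0n.
have -> : (\sum_(n0 + K <= k <oo) (phi k)%:E)%E = far_arrivals s n0 K w.
  rewrite -nneseries_addn; last by move=> i; rewrite lee_fin.
  apply: eq_eseriesr => i _; rewrite /phi.
  by have -> : (n0%:Z - (i + (n0 + K))%N%:Z) = - (K + i)%N%:Z by lia.
rewrite sumEFin big_mkord big_split_ord/=.
have phi1 (k : 'I_n0) : phi k = 1 - \1_(late s (n0%:Z - k%:Z)) w.
  rewrite /phi /late !indicE; have := xi0 (n0%:Z - k%:Z); set x := xi _ w => x0.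
  have j1 : 1 <= (n0%:Z - k%:Z)%:~R :> R.
    by rewrite -[1]/(1%:Z%:~R) ler_int; have := ltn_ord k; lia.
  have -> : (w \in [set w | s < (n0%:Z - k%:Z)%:~R + xi (n0%:Z - k%:Z) w]) =
      (s < (n0%:Z - k%:Z)%:~R + x) by apply/idP/idP; rewrite inE.
  have -> : ((n0%:Z - k%:Z)%:~R + x \in `]0%R, s]%classic) =
      (0 < (n0%:Z - k%:Z)%:~R + x <= s) by apply/idP/idP; rewrite inE /= in_itv/=.
  have -> : 0 < (n0%:Z - k%:Z)%:~R + x by lra.
  by case: ltP => _ /=; rewrite ?subrr ?subr0.
have phi2 (k : 'I_K) : phi (n0 + k)%N = \1_(late 0 (0%N%:Z - k%:Z)) w - \1_(late s (- k%:Z)) w.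
  rewrite /phi /late !indicE.
  have -> : n0%:Z - (n0 + k)%N%:Z = - k%:Z by lia.
  have -> : 0%N%:Z - k%:Z = - k%:Z by lia.
  set x := (- k%:Z)%:~R + xi _ w.
  have s0 : 0 <= s by rewrite (le_trans _ n0s1).
  have -> : (w \in [set w | 0 < (- k%:Z)%:~R + xi (- k%:Z) w]) = (0 < x).
    by apply/idP/idP; rewrite inE.
  have -> : (w \in [set w | s < (- k%:Z)%:~R + xi (- k%:Z) w]) = (s < x).
    by apply/idP/idP; rewrite inE.
  have -> : (x \in `]0%R, s]%classic) = (0 < x <= s).
    by apply/idP/idP; rewrite inE /= in_itv/=.
  by case: (ltP 0 x) => x0; case: (ltP s x) => sx //=; rewrite ?subrr ?subr0//; lra.
have -> : \sum_(i < n0) phi i = n0%:R - (late_count s n0 K w +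
    \sum_(i < n0 - K) \1_(late s (n0%:Z - (K + i)%:Z)) w).
  rewrite (eq_bigr _ (fun k _ => phi1 k)) sumrB sumr_const card_ord; congr (_ - _).
  rewrite -(big_mkord xpredT (fun k => \1_(late s (n0%:Z - k%:Z)) w : R)).
  rewrite (@big_cat_nat _ _ _ K)//= big_mkord; congr (_ + _).
  rewrite -[X in index_iota X](add0n K) big_addn big_mkord; apply: eq_bigr => i _.
  by rewrite addnC.
have -> : \sum_(i < K) phi (n0 + i)%N = late_count 0 0 K w -
    \sum_(k < K) \1_(late s (- k%:Z)) w.
  by rewrite (eq_bigr _ (fun k _ => phi2 k)) sumrB.
set r1 := \sum_(i < n0 - K) _; set r2 := \sum_(k < K) _.
have r10 : 0 <= r1 by apply: sumr_ge0.
have r20 : 0 <= r2 by apply: sumr_ge0.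
have : (0 <= far_arrivals s n0 K w)%E by apply: nneseries_ge0 => i _ _; rewrite lee_fin.
case: (far_arrivals s n0 K w) => [r|_|//]; last by rewrite addey ?leey.
rewrite lee_fin => r0 /=; rewrite -EFinD lee_fin ler_norml; apply/andP; split; lra.
Qed.

End traffic.

(** Cutting the sum of the first n + M terms in two ways leaves, on the left-hand
    side, at most the M first terms. *)
Lemma telescope_shift_le (R : realDomainType) (a : nat -> R) (n M : nat) :
    (forall k, 0 <= a k) -> (forall k l, (k <= l)%N -> a l <= a k) ->
  \sum_(i < n) (a i - a (M + i)%N) <= M%:R * a 0%N.
Proof.
move=> a0 adec; rewrite sumrB.
have : \sum_(i < n) a i + \sum_(i < M) a (n + i)%N = \sum_(i < M) a i + \sum_(i < n) a (M +
    i)%N.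
  transitivity (\sum_(i < n + M) a i); first by rewrite big_split_ord.
  by rewrite -(big_mkord xpredT a) addnC big_mkord big_split_ord.
have : 0 <= \sum_(i < M) a (n + i)%N by apply: sumr_ge0.
have : \sum_(i < M) a i <= M%:R * a 0%N.
  rewrite mulr_natl -[X in _ *+ X]card_ord -sumr_const.
  by apply: ler_sum => i _; exact: adec.
lra.
Qed.

Section remainder.
Context (d : measure_display) (T : measurableType d) (R : realType).
Context (P : probability T R) (xi : int -> {RV P >-> R}).
Hypothesis xi_iid : iid xi.
Hypothesis xi_gt0 : forall j : int, {ae P, forall w, 0 < xi j w}.

Definition tail_prob (x : R) : R := fine (P [set w | x < xi 0 w]).

Lemma measurable_late s j : measurable (late xi s j).
Proof.
have -> : late xi s j = xi j @^-1` `]s - j%:~R, +oo[%classic.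
  by apply/seteqP; split => w /=; rewrite in_itv/= andbT ltrBlDl.
by rewrite -[X in measurable X]setTI; exact: measurable_funPT.
Qed.

Lemma probability_late s j : P (late xi s j) = (tail_prob (s - j%:~R))%:E.
Proof.
rewrite /tail_prob fineK ?fin_num_measure//; last first.
  have := measurable_late (s - j%:~R) 0; rewrite /late.
  by under [X in measurable X -> _]eq_set do rewrite add0r.
have [_ /(_ j 0 `]s - j%:~R, +oo[%classic)] := xi_iid.
rewrite /distribution /pushforward => /(_ (measurable_itv _)).
have -> : xi j @^-1` `]s - j%:~R, +oo[%classic = late xi s j.
  by apply/seteqP; split => w /=; rewrite in_itv/= andbT ltrBlDl.
have -> : xi 0 @^-1` `]s - j%:~R, +oo[%classic = [set w | s - j%:~R < xi 0 w].
  by apply/seteqP; split => w /=; rewrite in_itv/= andbT.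
by [].
Qed.

Lemma tail_ge0 x : 0 <= tail_prob x. Proof. by rewrite /tail_prob fine_ge0. Qed.

Lemma measurable_tail x : measurable [set w | x < xi 0 w].
Proof.
have := measurable_late x 0; rewrite /late.
by under [X in measurable X -> _]eq_set do rewrite add0r.
Qed.

Lemma tail_le1 x : tail_prob x <= 1.
Proof.
have m := measurable_tail x.
by rewrite /tail_prob -lee_fin fineK ?fin_num_measure// probability_le1.
Qed.

Lemma tail_nonincreasing x y : x <= y -> tail_prob y <= tail_prob x.
Proof.
move=> xy; have mx := measurable_tail x; have my := measurable_tail y.
rewrite /tail_prob fine_le ?fin_num_measure// le_measure ?inE//.
by move=> w /=; exact: le_lt_trans.
Qed.

Lemma ae_all_gt0 : {ae P, forall w, forall j, 0 < xi j w}.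
Proof.
have neg j : P.-negligible (~` [set w | 0 < xi j w]) by exact: xi_gt0.
suff : P.-negligible (~` [set w | forall j, 0 < xi j w]) by [].
apply: (@negligibleS _ _ _ P (\bigcup_k (~` [set w | 0 < xi (Posz k) w] `|`
    ~` [set w | 0 < xi (Negz k) w]))).
  move=> w /= /existsNP[[] k xk]; exists k => //=; [by left|by right].
by apply: negligible_bigcup => k; exact: negligibleU.
Qed.

Lemma integrable_indic A : measurable A -> P.-integrable setT (EFin \o \1_A).
Proof.
move=> mA; apply: (@bounded_integrable _ _ _ P _ 1) => // w.
by rewrite indicE ger0_norm ?ler0n// lern1 leq_b1.
Qed.

Lemma Rintegral_indic A : measurable A -> \int[P]_w \1_A w = fine (P A).
Proof. by move=> mA; rewrite /Rintegral integral_indic// setIT. Qed.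

(** The probability that customer -k arrives in ]0, s] is a difference of two values
    of the tail, at points s apart, so the series telescopes. *)
Lemma integral_far_arrivals (s : R) (n0 K : nat) : 0 <= s <= n0.+1%:R ->
  (\int[P]_w far_arrivals xi s n0 K w <= (n0.+1%:R * tail_prob K%:R)%:E)%E.
Proof.
move=> /andP[s0 sn0].
pose f (i : nat) (w : T) : R := \1_(`]0%R, s]%classic) ((- (K + i)%:Z)%:~R + xi (- (K + i)%:Z)
    w).
have fE i w : f i w = \1_(late xi 0 (- (K + i)%:Z)) w - \1_(late xi s (- (K + i)%:Z)) w.
  rewrite /f !indicE; set x := _ + _.
  have -> : (w \in late xi 0 (- (K + i)%:Z)) = (0 < x) by apply/idP/idP; rewrite inE.
  have -> : (w \in late xi s (- (K + i)%:Z)) = (s < x) by apply/idP/idP; rewrite inE.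
  have -> : (x \in `]0%R, s]%classic) = (0 < x <= s).
    by apply/idP/idP; rewrite inE /= in_itv/=.
  by case: (ltP 0 x) => x0; case: (ltP s x) => sx //=; rewrite ?subrr ?subr0//; lra.
have mf i : measurable_fun setT (f i).
  rewrite (_ : f i = fun w => \1_(late xi 0 (- (K + i)%:Z)) w - \1_(late xi s (- (K + i)%:Z))
      w); last exact/funext.
  by apply: measurable_funB; apply: measurable_indic; exact: measurable_late.
have intf i : (\int[P]_w (f i w)%:E = (tail_prob (K + i)%:R - tail_prob (s + (K + i)%:R))%:E)%E.
  transitivity (\int[P]_w (\1_(late xi 0 (- (K + i)%:Z)) w - \1_(late xi s (- (K + i)%:Z))
      w)%:E)%E.
    by apply: eq_integral => w _; rewrite fE.
  rewrite integralB_EFin//; last 2 first.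
  - exact/integrable_indic/measurable_late.
  - exact/integrable_indic/measurable_late.
  rewrite !integral_indic//; try exact: measurable_late.
  rewrite !setIT EFinB; congr (_ - _)%E.
    by rewrite [LHS]probability_late rmorphN/= sub0r opprK.
  by rewrite [LHS]probability_late rmorphN/= opprK.
rewrite integral_nneseries//; last by move=> i; exact/measurable_EFinP/mf.
apply: lime_le.
  apply: is_cvg_nneseries => i _ _; apply: integral_ge0 => w _.
  by rewrite lee_fin.
apply: nearW => n; rewrite big_mkord.
rewrite (eq_bigr _ (fun i _ => intf (nat_of_ord i))) sumEFin lee_fin.
have := @telescope_shift_le R (fun i => tail_prob (K + i)%:R) n n0.+1 (fun i => tail_ge0 _).
rewrite addn0; move=> H; apply: le_trans (H _); last first.
  by move=> k l kl; apply: tail_nonincreasing; rewrite ler_nat leq_add2l.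
apply: ler_sum => i _; rewrite lerD2l lerN2; apply: tail_nonincreasing.
by rewrite addnCA (natrD _ n0.+1) lerD2r.
Qed.

(** For K and s of order n and a tail of order 1 / x, every term of the bound is O(1). *)
Lemma traffic_remainder (s : R) (n0 K : nat) : n0%:R <= s < n0.+1%:R -> (K <= n0)%N ->
  let D := fun w => fine (traffic_count xi s w) - n0%:R
             - (late_count xi 0 0 K w - late_count xi s n0 K w) in
  measurable_fun setT D ->
  P.-integrable setT (EFin \o D) /\
  \int[P]_w `|D w| <= (n0.*2.+1)%:R * tail_prob K%:R + K%:R * tail_prob s.
Proof.
move=> n0s Kn0 D mD; have /andP[n0s1 n0s2] := n0s.
have s0 : 0 <= s by rewrite (le_trans _ n0s1).
pose r w : R := \sum_(i < n0 - K) \1_(late xi s (n0%:Z - (K + i)%:Z)) w +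
       \sum_(k < K) \1_(late xi s (- k%:Z)) w.
have ir1 : P.-integrable setT (EFin \o (fun w => \sum_(i < n0 - K) \1_(late xi s (n0%:Z - (K +
    i)%:Z)) w)).
  by apply: integrable_sumr => i; exact/integrable_indic/measurable_late.
have ir2 : P.-integrable setT (EFin \o (fun w => \sum_(k < K) \1_(late xi s (- k%:Z)) w)).
  by apply: integrable_sumr => i; exact/integrable_indic/measurable_late.
have ir : P.-integrable setT (EFin \o r) by exact: integrable_addr.
have r0 w : 0 <= r w by rewrite addr_ge0// sumr_ge0.
have mfar : measurable_fun setT (far_arrivals xi s n0 K).
  apply: ge0_emeasurable_sum => [k w _ _|k _]; first by rewrite lee_fin.
  apply/measurable_EFinP.
  apply: (measurableT_comp (measurable_indic _)) => //.
  exact: measurable_funD.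
have far0 w : (0 <= far_arrivals xi s n0 K w)%E.
  by apply: nneseries_ge0 => i _ _; rewrite lee_fin.
have mr := measurable_int P ir.
have bound : (\int[P]_w `|(D w)%:E| <= ((n0.*2.+1)%:R * tail_prob K%:R + K%:R * tail_prob
    s)%:E)%E.
  apply: (@le_trans _ _ (\int[P]_w ((r w)%:E + far_arrivals xi s n0 K w))%E).
    apply: ae_ge0_le_integral => //.
    - by apply: measurableT_comp => //; exact/measurable_EFinP.
    - by move=> w _; rewrite adde_ge0// lee_fin.
    - exact: emeasurable_funD.
    - have [N [mN PN NP]] := ae_all_gt0; exists N; split => // w h.
      apply: NP => xiw; apply: h => wT.
      exact: traffic_count_decomposition n0s Kn0 xiw.
  rewrite ge0_integralD//; last first.
    by move=> w _; rewrite lee_fin.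
  have -> : (\int[P]_w (r w)%:E = (\int[P]_w r w)%:E)%E.
    by rewrite /Rintegral fineK//; exact: integrable_fin_num.
  have fle : (\int[P]_w far_arrivals xi s n0 K w <= (n0.+1%:R * tail_prob K%:R)%:E)%E.
    by apply: integral_far_arrivals; rewrite s0 ltW.
  rewrite (le_trans (leeD2l _ fle))// -EFinD lee_fin.
  rewrite /r RintegralD// !Rintegral_sumr//; last 2 first.
  - by move=> i; exact/integrable_indic/measurable_late.
  - by move=> i; exact/integrable_indic/measurable_late.
  have h1 : \sum_(i < n0 - K) \int[P]_w \1_(late xi s (n0%:Z - (K + i)%:Z)) w <= n0%:R *
      tail_prob K%:R.
    apply: (@le_trans _ _ (\sum_(i < n0 - K) tail_prob K%:R)).
      apply: ler_sum => i _; rewrite Rintegral_indic; last exact: measurable_late.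
      rewrite probability_late /=; apply: tail_nonincreasing.
      rewrite rmorphB/= -!pmulrn natrD; have := ler0n R i; lra.
    rewrite sumr_const card_ord -[leLHS]mulr_natl ler_wpM2r ?tail_ge0// ler_nat.
    exact: leq_subr.
  have h2 : \sum_(k < K) \int[P]_w \1_(late xi s (- k%:Z)) w <= K%:R * tail_prob s.
    apply: (@le_trans _ _ (\sum_(i < K) tail_prob s)).
      apply: ler_sum => i _; rewrite Rintegral_indic; last exact: measurable_late.
      rewrite probability_late /=; apply: tail_nonincreasing.
      by rewrite rmorphN/= opprK -pmulrn lerDl.
    by rewrite sumr_const card_ord -[leLHS]mulr_natl.
  rewrite -addnn -addnS natrD; lra.
have iD : P.-integrable setT (EFin \o D).
  apply/integrableP; split; first exact/measurable_EFinP.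
  by rewrite (le_lt_trans bound)// ltry.
split => //; rewrite -lee_fin (le_trans _ bound)//.
rewrite /Rintegral fineK//.
exact: integrable_fin_num (integrable_norm iD).
Qed.

End remainder.

(** * Sums of a tail equivalent to c / x *)

Section tail_sums.
Context {R : realType}.

(** With the next lemma, sums of inverses telescope to logarithms. *)
Lemma inv_le_ln_increment (k : nat) : (0 < k)%N ->
  k.+1%:R^-1 <= ln (k.+1%:R : R) - ln k%:R :> R.
Proof.
move=> k0; have kR : 0 < k%:R :> R by rewrite ltr0n.
have kS : 0 < k.+1%:R :> R by rewrite ltr0n.
rewrite -lerN2 opprB -ln_div ?posrE//.
have -> : k%:R / k.+1%:R = 1 + (- k.+1%:R^-1) :> R.
  by rewrite -natr1; field; rewrite natr1 gt_eqF.
apply: le_ln1Dx; rewrite ltrN2 invf_lt1// ltr1n ltnS//.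
Qed.

Lemma ln_increment_le_inv (k : nat) : (0 < k)%N ->
  ln (k.+1%:R : R) - ln k%:R <= k%:R^-1 :> R.
Proof.
move=> k0; have kR : 0 < k%:R :> R by rewrite ltr0n.
have kS : 0 < k.+1%:R :> R by rewrite ltr0n.
rewrite -ln_div ?posrE//.
have -> : k.+1%:R / k%:R = 1 + k%:R^-1 :> R.
  by rewrite -natr1; field; rewrite gt_eqF.
by apply: le_ln1Dx; rewrite (lt_trans _ (_ : 0 < _)) ?invr_gt0.
Qed.

(** The shift by 1/2 makes the telescoping bound hold from K = 0 on. *)
Lemma sum_inv_sqr_le (K : nat) : \sum_(k < K) (k.+1%:R^-1) ^+ 2 <= 2 :> R.
Proof.
suff : \sum_(k < K) (k.+1%:R^-1) ^+ 2 <= 2 - (K%:R + 2^-1)^-1 :> R.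
  by move=> /le_trans; apply; rewrite gerBl invr_ge0 addr_ge0// invr_ge0.
elim: K => [|K IH]; first by rewrite big_ord0 add0r invrK subrr.
rewrite big_ord_recr/= -natr1; set N : R := K%:R in IH *.
have N0 : 0 <= N by exact: ler0n.
suff : (N + 1)^-1 ^+ 2 <= (N + 2^-1)^-1 - (N + 1 + 2^-1)^-1 by lra.
have -> : (N + 2^-1)^-1 - (N + 1 + 2^-1)^-1 = ((N + 2^-1) * (N + 1 + 2^-1))^-1.
  by field; apply/andP; split; rewrite gt_eqF//; lra.
rewrite exprVn lef_pV2 ?posrE; [nra| |].
  by rewrite exprn_gt0//; lra.
by rewrite mulr_gt0//; lra.
Qed.

Variables (G : R -> R) (c : R).
Hypothesis G_ge0 : forall x, 0 <= G x.
Hypothesis G_le1 : forall x, G x <= 1.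
Hypothesis c_gt0 : 0 < c.
Hypothesis G_lim : G x / (c / x) @[x --> +oo] --> (1 : R).

Lemma tail_near (e : R) : 0 < e -> exists2 M : nat, (0 < M)%N &
  forall x : R, M%:R <= x -> (1 - e) * (c / x) <= G x <= (1 + e) * (c / x).
Proof.
move=> e0; move/cvgrPdist_le : G_lim => /(_ _ e0) [A [_ HA]].
exists (`|Num.trunc A|).+1 => // x Mx.
have Ax : A < x by rewrite (lt_le_trans _ Mx)// truncnS_gt.
have x0 : 0 < x by rewrite (lt_le_trans _ Mx).
have cx : 0 < c / x by rewrite divr_gt0.
have := HA _ Ax; rewrite /= distrC ler_distl => /andP[a b].
by apply/andP; split; [rewrite -ler_pdivlMr//|rewrite -ler_pdivrMr//].
Qed.

Lemma tail_bound : exists2 C : R, 0 < C & forall x : R, 0 <= x -> G x <= C / (1 + x).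
Proof.
have [M M0 HM] := tail_near ltr01.
have M1 : 1 <= M%:R :> R by rewrite ler1n.
have c0 := c_gt0; exists (4 * c + 1 + M%:R) => [|x x0]; first by lra.
rewrite ler_pdivlMr; last by lra.
have [xM|Mx] := ltP x M%:R.
  have := G_le1 x; have := G_ge0 x; nra.
have /andP[_] := HM _ Mx.
have x1 : 1 <= x by rewrite (le_trans M1).
rewrite mulrA ler_pdivlMr; last by lra.
have := G_ge0 x; nra.
Qed.

(** Uniformity in the offset th is needed because the fractional part of n u varies
    with n. The terms before the rank where G(x) is close to c / x go into B. *)
Lemma tail_sum_ln (e : R) : 0 < e -> exists B : R, forall (K : nat) (th : R), 0 <= th <= 1 ->
  `|\sum_(k < K) G (k%:R + th) - c * ln K.+1%:R| <= e * ln K.+1%:R + B.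
Proof.
move=> e0; have c0 := c_gt0; have [e' e'E] : exists e' : R, e' = e / c by eexists.
have e'0 : 0 < e' by rewrite e'E divr_gt0.
have [M M0 HM] := tail_near e'0.
have ec : e' * c = e by rewrite e'E divfK ?gt_eqF.
have lnS_ge0 k : 0 <= ln k.+1%:R :> R by rewrite ln_ge0// ler1n.
exists (M.+1%:R + (c + e) * ln M.+1%:R) => K th /andP[th0 th1].
have split_sum : \sum_(k < K) G (k%:R + th) =
    \sum_(0 <= k < minn M K) G (k%:R + th) + \sum_(minn M K <= k < K) G (k%:R + th).
  by rewrite -big_cat_nat ?geq_minr// big_mkord.
have head_ge0 : 0 <= \sum_(0 <= k < minn M K) G (k%:R + th) by apply: sumr_ge0.
have head_le : \sum_(0 <= k < minn M K) G (k%:R + th) <= M%:R.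
  rewrite big_mkord (le_trans (ler_sum _ (fun k _ => G_le1 _)))//.
  by rewrite sumr_const card_ord ler_nat geq_minl.
have eK : 0 <= e * ln K.+1%:R by rewrite mulr_ge0// ltW.
have eM : 0 <= e * ln M.+1%:R by rewrite mulr_ge0// ltW.
have cM : 0 <= c * ln M.+1%:R by rewrite mulr_ge0// ltW.
have cK : 0 <= c * ln K.+1%:R by rewrite mulr_ge0// ltW.
have MR := ler0n R M.+1.
move: split_sum head_ge0 head_le; have [MK|KM] := leqP M K => split_sum head_ge0 head_le; last
    first.
  have h : ln K.+1%:R <= ln M.+1%:R :> R by rewrite ler_ln ?posrE// ler_nat ltnS ltnW.
  have ch := ler_wpM2l (ltW c0) h.
  have MM : M%:R <= M.+1%:R :> R by rewrite ler_nat.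
  rewrite [X in _ + X]big_geq// addr0 in split_sum.
  by rewrite split_sum ler_distl mulrDl; apply/andP; split; lra.
rewrite split_sum ler_distl; apply/andP; split.
- have low : (1 - e') * c * (ln K.+1%:R - ln M.+1%:R) <= \sum_(M <= k < K) G (k%:R + th).
    have lnMK : 0 <= ln K.+1%:R - ln M.+1%:R :> R.
      by rewrite subr_ge0 ler_ln ?posrE// ler_nat.
    have [e'1|e'1] := leP 1 e'.
      rewrite (@le_trans _ _ 0)// ?sumr_ge0// -mulrA mulr_le0_ge0 ?subr_le0//.
      by rewrite mulr_ge0// ltW.
    rewrite -(@telescope_sumr _ M K (fun k => ln k.+1%:R : R))// mulr_sumr.
    apply: ler_sum_nat => k /andP[Mk _].
    have Mk' : M%:R <= k%:R :> R by rewrite ler_nat.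
    have k0 : 0 < k%:R :> R by rewrite ltr0n (leq_trans M0).
    have Mkth : M%:R <= k%:R + th by lra.
    have /andP[Gk _] := HM _ Mkth.
    apply: le_trans Gk; rewrite -mulrA ler_wpM2l ?subr_ge0 ?(ltW e'1)//.
    rewrite ler_wpM2l ?(ltW c_gt0)// (le_trans (ln_increment_le_inv (ltn0Sn k)))//.
    by rewrite lef_pV2 ?posrE// -?natr1; lra.
  by move: low head_ge0; rewrite !mulrBl mul1r ec mulrBr mulrDl !mulrBr; lra.
- have [EMK|MK'] := eqVneq M K.
    subst K; rewrite [X in _ + X]big_geq// addr0.
    have MM : M%:R <= M.+1%:R :> R by rewrite ler_nat.
    by move: head_le; rewrite mulrDl; lra.
  have {}MK : (M < K)%N by rewrite ltn_neqAle MK'.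
  have up i : \sum_(M <= k < M.+1 + i) G (k%:R + th) <=
      1 + (1 + e') * c * (ln (M + i)%:R - ln M%:R).
    elim: i => [|i IH].
      by rewrite !addn0 subrr mulr0 addr0 big_nat1.
    rewrite addnS big_nat_recr/=; last by rewrite ltnW// leq_addr.
    have k0 : (0 < M + i)%N by rewrite (leq_trans M0)// leq_addr.
    have step := inv_le_ln_increment k0.
    have Mk : M%:R <= (M.+1 + i)%:R + th.
      have : M%:R <= (M.+1 + i)%:R :> R by rewrite ler_nat ltnW// leq_addr.
      lra.
    have /andP[_ Gk] := HM _ Mk.
    have : G ((M.+1 + i)%:R + th) <= (1 + e') * c * (ln (M + i).+1%:R - ln (M + i)%:R).
      apply: (le_trans Gk); rewrite -mulrA ler_wpM2l ?addr_ge0 ?(ltW e'0)//.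
      rewrite ler_wpM2l ?(ltW c_gt0)//; apply: le_trans step.
      by rewrite lef_pV2 ?posrE ?ltr0n// ?addSn ?lerDl//; have := ltr0Sn R (M + i); lra.
    by rewrite addnS; lra.
  have := up (K - M.+1)%N; rewrite subnKC// => {}up.
  have lnK : ln (M + (K - M.+1))%:R <= ln K.+1%:R :> R.
    have pos : (0 < M + (K - M.+1))%N by rewrite addn_gt0 M0.
    have le : (M + (K - M.+1) <= K.+1)%N by clear -MK; lia.
    by rewrite ler_ln ?posrE ?ltr0n// ler_nat.
  have lnM : 0 <= ln M%:R :> R by rewrite ln_ge0// ler1n.
  have := lnS_ge0 M; have : M%:R + 1 = M.+1%:R :> R by rewrite natr1.
  rewrite mulrDl mul1r ec in up.
  have h1 : (c + e) * ln (M + (K - M.+1))%:R <= (c + e) * ln K.+1%:R.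
    by rewrite ler_wpM2l// addr_ge0// ltW.
  have h2 : 0 <= (c + e) * ln M%:R by rewrite mulr_ge0// addr_ge0// ltW.
  by move: up h1 h2 head_le; rewrite mulrBr !mulrDl; lra.
Qed.

End tail_sums.

Section block_tail_sums.
Context {R : realType}.

Lemma near_ln_ge (A : R) : \forall n \near \oo, A <= ln (n%:R : R).
Proof.
near=> n.
have n0 : 0 < n%:R :> R by rewrite ltr0n; near: n; exact: nbhs_infty_gt.
rewrite -ler_expR lnK ?posrE//; near: n; exact: nbhs_infty_ger.
Unshelve. all: by end_near. Qed.

Lemma cvg_inv_ln : (ln (n%:R : R))^-1 @[n --> \oo] --> (0 : R).
Proof.
apply/cvgrPdist_le => e e0.
near=> n.
have en : e^-1 <= ln (n%:R : R) by near: n; exact: near_ln_ge.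
have L0 : 0 < ln (n%:R : R) by rewrite (lt_le_trans _ en)// invr_gt0.
by rewrite sub0r normrN ger0_norm ?invr_ge0 ?(ltW L0)// -[e]invrK lef_pV2 ?posrE ?invr_gt0.
Unshelve. all: by end_near. Qed.

Lemma cvg_inv_sqrt_ln : (Num.sqrt (ln (n%:R : R)))^-1 @[n --> \oo] --> (0 : R).
Proof.
apply/cvgrPdist_le => e e0.
near=> n.
have en : e^-1 ^+ 2 <= ln (n%:R : R) by near: n; exact: near_ln_ge.
have e2 : 0 < e^-1 by rewrite invr_gt0.
have L0 : 0 < ln (n%:R : R) by rewrite (lt_le_trans _ en)// exprn_gt0.
rewrite sub0r normrN ger0_norm ?invr_ge0 ?sqrtr_ge0//.
rewrite -[leRHS]invrK lef_pV2 ?posrE ?sqrtr_gt0//.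
by rewrite -(ger0_norm (ltW e2)) -sqrtr_sqr ler_sqrt// ltW.
Unshelve. all: by end_near. Qed.

Variables (G : R -> R) (c : R).
Hypothesis G_ge0 : forall x, 0 <= G x.
Hypothesis G_le1 : forall x, G x <= 1.
Hypothesis G_dec : forall x y, x <= y -> G y <= G x.
Hypothesis c_gt0 : 0 < c.
Hypothesis G_lim : G x / (c / x) @[x --> +oo] --> (1 : R).
Variable delta : R.
Hypothesis delta_gt0 : 0 < delta.

(** The number of schedules retained before each time. *)
Definition block (n : nat) : nat := Num.trunc (delta * n%:R).

Lemma block_bounds n : (block n)%:R <= delta * n%:R < (block n).+1%:R.
Proof.
have dn : 0 <= delta * n%:R by rewrite mulr_ge0// ltW.
exact: truncn_itv.
Qed.

(** A block length proportional to n changes log n by a bounded amount only. *)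
Lemma ln_block n : (0 < n)%N ->
  `|ln (block n).+1%:R - ln (n%:R : R)| <= `|ln delta| + ln (1 + delta).
Proof.
move=> n0; have /andP[b1 b2] := block_bounds n.
have nR : 1 <= n%:R :> R by rewrite ler1n.
have nR0 : 0 < n%:R :> R by rewrite ltr0n.
have d0 := delta_gt0.
have h0 : 0 <= ln (1 + delta) by rewrite ln_ge0// lerDl ltW.
have lo : ln delta + ln n%:R <= ln (block n).+1%:R.
  by rewrite -lnM ?posrE// ler_ln ?posrE ?mulr_gt0// ltW.
have hi : ln (block n).+1%:R <= ln (1 + delta) + ln n%:R.
  rewrite -lnM ?posrE ?addr_gt0// ler_ln ?posrE ?mulr_gt0 ?addr_gt0// -natr1.
  nra.
have := ler_norm (- ln delta); rewrite normrN => hd.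
rewrite ler_norml; apply/andP; split; first by lra.
by have := normr_ge0 (ln delta); lra.
Qed.

Lemma cvg_block_sum (th : nat -> R) : (forall n, 0 <= th n <= 1) ->
  (\sum_(k < block n) G (k%:R + th n)) / ln n%:R @[n --> \oo] --> c.
Proof.
move=> th01; apply/cvgrPdist_le => e e0.
have e20 : 0 < e / 2 by rewrite divr_gt0.
have [B HB] := tail_sum_ln G_ge0 G_le1 c_gt0 G_lim e20.
pose B2 := `|ln delta| + ln (1 + delta).
have c0 := c_gt0.
near=> n.
have n0 : (0 < n)%N by near: n; exact: nbhs_infty_gt.
have LA : (`|B| + (e / 2 + c) * B2) / (e / 2) + 1 <= ln (n%:R : R) by near: n; exact:
    near_ln_ge.
have B20 : 0 <= B2 by rewrite addr_ge0// ln_ge0// lerDl ltW.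
have A0 : 0 <= (`|B| + (e / 2 + c) * B2) / (e / 2).
  by rewrite divr_ge0 ?(ltW e20)// addr_ge0// mulr_ge0// addr_ge0// ltW.
have L0 : 0 < ln (n%:R : R) by lra.
have := HB (block n) _ (th01 n); have := ln_block n0; rewrite -/B2.
set S := \sum_(k < _) _; set l1 := ln (block n).+1%:R; set l := ln n%:R in LA L0 *.
move=> l1l SB.
have -> : c - S / l = (c * l - S) / l by field; rewrite gt_eqF.
rewrite normrM normfV (gtr0_norm L0) ler_pdivrMr//.
have LB : `|B| + (e / 2 + c) * B2 <= e / 2 * l.
  rewrite [leRHS]mulrC -ler_pdivrMr//; lra.
have cl : `|c * l - c * l1| <= c * B2.
  by rewrite -mulrBr normrM (gtr0_norm c0) ler_wpM2l ?(ltW c0)// distrC.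
have l1u : e / 2 * l1 <= e / 2 * l + e / 2 * B2.
  rewrite -mulrDr ler_wpM2l ?(ltW e20)//.
  by move: l1l; rewrite ler_norml => /andP[_]; lra.
have := ler_distD (c * l1) (c * l) S; rewrite (distrC (c * l1) S) => tri.
rewrite (le_trans tri)//.
have := ler_norm B; move: LB; rewrite mulrDl; lra.
Unshelve. all: by end_near. Qed.

Lemma block_sum_sqr_bound : exists C : R, forall (K : nat) (th : R), 0 <= th ->
  \sum_(k < K) G (k%:R + th) ^+ 2 <= C.
Proof.
have [C C0 HC] := tail_bound G_ge0 G_le1 c_gt0 G_lim.
exists (C ^+ 2 * 2) => K th th0.
rewrite (le_trans _ (ler_wpM2l (sqr_ge0 C) (sum_inv_sqr_le K)))// mulr_sumr.
apply: ler_sum => k _; rewrite -exprMn lerXn2r ?nnegrE ?mulr_ge0 ?(ltW C0)//.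
have k0 := ler0n R k.
have kth : 0 <= k%:R + th by lra.
rewrite (le_trans (HC _ kth))// ler_wpM2l ?(ltW C0)// lef_pV2 ?posrE ?ltr0n// -?natr1; lra.
Qed.

(** Monotonicity of G: the difference of the two sums is bounded by a telescoping one.
    Hence the means of the counts at times 0 and n t differ by at most 1, which the
    division by sqrt(log n) makes negligible. *)
Lemma block_sum_shift (K : nat) (th : R) : 0 <= th <= 1 ->
  `|\sum_(k < K) G (k%:R + 0) - \sum_(k < K) G (k%:R + th)| <= 1.
Proof.
move=> /andP[th0 th1]; rewrite -sumrB ger0_norm; last first.
  by apply: sumr_ge0 => k _; rewrite subr_ge0; apply: G_dec; rewrite lerD2l.
apply: (@le_trans _ _ (\sum_(k < K) (G k%:R - G k.+1%:R))).
  apply: ler_sum => k _; rewrite addr0 lerD2l lerN2; apply: G_dec.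
  by rewrite -natr1 lerD2l.
have -> : \sum_(k < K) (G k%:R - G k.+1%:R) = G 0 - G K%:R.
  elim: K => [|K IH]; first by rewrite big_ord0 subrr.
  by rewrite big_ord_recr/= IH addrA subrK.
by rewrite (le_trans _ (G_le1 0))// gerBl.
Qed.

Lemma block_remainder_bound (t : R) : 0 < t -> exists C : R, \forall n \near \oo,
  (block n <= Num.trunc (n%:R * t))%N ->
  ((Num.trunc (n%:R * t)).*2.+1)%:R * G (block n)%:R + (block n)%:R * G (n%:R * t) <= C.
Proof.
move=> t0.
have [C C0 HC] := tail_bound G_ge0 G_le1 c_gt0 G_lim.
exists (C * (2 * t + 1) / delta + C); near=> n => Kt.
have n0 : (0 < n)%N by near: n; exact: nbhs_infty_gt.
have nR : 1 <= n%:R :> R by rewrite ler1n.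
have /andP[b1 b2] := block_bounds n.
have d0 := delta_gt0.
have nt0 : 0 <= n%:R * t by rewrite mulr_ge0// ltW.
have /andP[f1 f2] := truncn_itv nt0.
have K0 := ler0n R (block n).
have KR : (block n)%:R <= n%:R * t by rewrite (le_trans _ f1)// ler_nat.
apply: lerD.
  have h := HC _ K0; rewrite addrC natr1 in h.
  apply: (@le_trans _ _ ((2 * t + 1) * n%:R * (C / (delta * n%:R)))).
    apply: ler_pM => //.
      rewrite -natr1 -muln2 natrM; nra.
    rewrite (le_trans h)// ler_wpM2l ?(ltW C0)// lef_pV2 ?posrE ?mulr_gt0//; lra.
  rewrite le_eqVlt; apply/orP; left; apply/eqP; field.
  by rewrite !gt_eqF//; lra.
have h := HC _ nt0.
apply: (le_trans (ler_wpM2l K0 h)); rewrite mulrA ler_pdivrMr; last by lra.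
nra.
Unshelve. all: by end_near. Qed.

End block_tail_sums.

(** * Counts of late customers over blocks of schedules *)

Section blocks.
Context (d : measure_display) (T : measurableType d) (R : realType).
Context (P : probability T R) (xi : int -> {RV P >-> R}).
Hypothesis xi_iid : iid xi.

(** Independence is stated for one set per variable, so the events are transported
    along f, which is injective on L: no customer is used twice. *)
Lemma independent_late (I : eqType) (x : I -> R) (f : I -> int) (L : seq I) :
  {in L &, injective f} -> independent_events P (fun i => late xi (x i) (f i)) L.
Proof.
move=> finj [|i0 J0]; first by rewrite classical_sets.set_nil bigcap_set0 big_nil
    probability_setT.
set J := i0 :: J0 => uJ JL.
(* For j outside the image of f, the index is the size of J and nth returns i0. *)
pose A j : set R := `](x (nth i0 J (index j (map f J))) - j%:~R), +oo[%classic.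
have nthf i : i \in J -> nth i0 J (index (f i) (map f J)) = i.
  move=> iJ; have fi : f i \in map f J by exact: map_f.
  have szi : (index (f i) (map f J) < size J)%N by rewrite -(size_map f) index_mem.
  apply: finj; [by apply: JL; exact: mem_nth|exact: JL|].
  by rewrite -(nth_map _ (f i0))// nth_index.
have AE i : i \in J -> xi (f i) @^-1` A (f i) = late xi (x i) (f i).
  move=> iJ; rewrite /A nthf//.
  by apply/seteqP; split => w /=; rewrite in_itv/= andbT ltrBlDl.
have [indep _] := xi_iid.
have ufJ : uniq (map f J).
  by rewrite map_inj_in_uniq// => i j iJ jJ; apply: finj; exact: JL.
have := indep (map f J) A ufJ (fun j => measurable_itv _).
rewrite big_map => H.
transitivity (P (\bigcap_(j in [set` map f J]) xi j @^-1` A j)).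
  congr (P _); apply/seteqP; split => w H'.
    by move=> _ /mapP[i iJ ->]; rewrite AE//; exact: H'.
  by move=> i /= iJ; rewrite -AE//; apply: H'; exact: map_f.
rewrite H big_seq [RHS]big_seq; apply: eq_bigr => i iJ.
by rewrite -AE.
Qed.

Variable delta : R.
Hypothesis delta_gt0 : 0 < delta.

Local Notation fl n u := (Num.trunc (n%:R * u)).

Definition frac (n : nat) (u : R) : R := n%:R * u - (fl n u)%:R.

Lemma frac01 n u : 0 <= u -> 0 <= frac n u <= 1.
Proof.
move=> u0; have /truncn_itv/andP[a b] : 0 <= n%:R * u by rewrite mulr_ge0.
rewrite /frac subr_ge0 a/= lerBlDr addrC natr1; exact: ltW.
Qed.

(** The index (u, k) stands for the customer scheduled k places before the last
    schedule that precedes n u. *)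
Definition block_event (n : nat) (i : R * nat) : set T :=
  late xi (n%:R * i.1) ((fl n i.1)%:Z - i.2%:Z).

Definition block_index (U : seq R) (n : nat) : seq (R * nat) :=
  [seq (u, k) | u <- U, k <- iota 0 (block delta n)].

Definition block_mean (n : nat) (u : R) : R :=
  \sum_(k < block delta n) tail_prob xi (k%:R + frac n u).

Definition block_var (n : nat) (u : R) (w : T) : R :=
  (Num.sqrt (ln n%:R))^-1 *
  (late_count xi (n%:R * u) (fl n u) (block delta n) w - block_mean n u).

Lemma probability_block_event n i :
  fine (P (block_event n i)) = tail_prob xi (i.2%:R + frac n i.1).
Proof.
rewrite /block_event probability_late//=; congr tail_prob.
by rewrite /frac rmorphB/= -!pmulrn; ring.
Qed.

Lemma sum_block_index (V : nmodType) (U : seq R) n (F : R -> nat -> V) :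
  \sum_(i <- block_index U n) F i.1 i.2 =
  \sum_(u <- U) \sum_(k < block delta n) F u k.
Proof.
rewrite big_allpairs_dep; apply: eq_bigr => u _.
by rewrite -[X in iota _ X]subn0 big_mkord.
Qed.

Lemma centered_sum_block (U : seq R) (b : R -> R) n w :
  centered_sum P (block_event n) (fun i => b i.1 / Num.sqrt (ln n%:R)) (block_index U n) w =
  \sum_(u <- U) b u * block_var n u w.
Proof.
rewrite /centered_sum.
under eq_bigr do rewrite probability_block_event.
rewrite (sum_block_index U n (fun u k => b u / Num.sqrt (ln n%:R) *
  (\1_(late xi (n%:R * u) ((fl n u)%:Z - k%:Z)) w - tail_prob xi (k%:R + frac n u)))).
apply: eq_bigr => u _; rewrite -mulr_sumr mulrA; congr (_ * _).
by rewrite sumrB.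
Qed.

Lemma block_index_uniq U n : uniq U -> uniq (block_index U n).
Proof.
move=> uU; apply: allpairs_uniq => //; first exact: iota_uniq.
by move=> [u k] [v l] /= _ _ [-> ->].
Qed.

(** A gap 2 delta leaves room for the effect of rounding n u once delta n >= 1. *)
Definition separated (U : seq R) : Prop :=
  (forall u, u \in U -> 0 <= u) /\
  (forall u v, u \in U -> v \in U -> u < v -> u + 2 * delta <= v).

Lemma separated_fl U n u v : separated U -> 1 <= delta * n%:R ->
  u \in U -> v \in U -> u < v -> (fl n u + block delta n <= fl n v)%N.
Proof.
move=> [U0 Usep] dn uU vU uv.
have nu0 : 0 <= n%:R * u by rewrite mulr_ge0// U0.
have nv0 : 0 <= n%:R * v by rewrite mulr_ge0// U0.
have /andP[u1 u2] := truncn_itv nu0; have /andP[v1 v2] := truncn_itv nv0.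
have /andP[b1 b2] := block_bounds delta_gt0 n.
have sep : n%:R * u + 2 * (delta * n%:R) <= n%:R * v.
  have := ler_wpM2l (ler0n R n) (Usep _ _ uU vU uv); lra.
suff : (fl n u + block delta n)%:R < (fl n v).+1%:R :> R by rewrite ltr_nat ltnS.
rewrite natrD; lra.
Qed.

(** Blocks of distinct times do not overlap. *)
Lemma block_index_inj U n : separated U -> 1 <= delta * n%:R ->
  {in block_index U n &, injective (fun i => (fl n i.1)%:Z - i.2%:Z)}.
Proof.
move=> sU dn i j /allpairsPdep[u [k [uU + ->]]] /allpairsPdep[v [l [vU + ->]]] /=.
rewrite !mem_iota !add0n => kK lK E.
have disjoint (a b K k' l' : nat) : (a + K <= b)%N -> (l' < K)%N ->
    a%:Z - k'%:Z = b%:Z - l'%:Z -> False by lia.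
have [uv|vu|uv] := ltgtP u v.
- by case: (disjoint _ _ _ _ _ (separated_fl sU dn uU vU uv) lK E).
- by case: (disjoint _ _ _ _ _ (separated_fl sU dn vU uU vu) kK (esym E)).
- by rewrite -uv in E *; congr pair; move: E; clear; lia.
Qed.

Lemma independent_blocks U n : separated U -> 1 <= delta * n%:R ->
  independent_events P (block_event n) (block_index U n).
Proof.
by move=> sU dn; apply: independent_late; exact: block_index_inj.
Qed.

End blocks.

Lemma cvg_sum_seq (R : realType) (I : eqType) (s : seq I) (f : I -> nat -> R) (l : I -> R) :
    (forall i, i \in s -> f i n @[n --> \oo] --> l i) ->
  \sum_(i <- s) f i n @[n --> \oo] --> \sum_(i <- s) l i.
Proof.
elim: s => [|i s IH] fl.
  by under eq_fun do rewrite big_nil; rewrite big_nil; exact: cvg_cst.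
under eq_fun do rewrite big_cons; rewrite big_cons.
apply: cvgD; first by apply: fl; rewrite mem_head.
by apply: IH => j js; apply: fl; rewrite inE js orbT.
Qed.

Section block_limits.
Context (d : measure_display) (T : measurableType d) (R : realType).
Context (P : probability T R) (xi : int -> {RV P >-> R}) (c : R).
Hypothesis xi_iid : iid xi.
Hypothesis c_gt0 : 0 < c.
Hypothesis xi_tail : fine (P [set w | x < xi 0 w]) / (c / x) @[x --> +oo] --> (1 : R).
Variable delta : R.
Hypothesis delta_gt0 : 0 < delta.

Local Notation L n := (ln (n%:R : R)).
Local Notation q n := (Num.sqrt (ln (n%:R : R))).
Local Notation mean := (block_mean xi delta).

Let G_lim : tail_prob xi x / (c / x) @[x --> +oo] --> (1 : R) := xi_tail.
Let G_ge0 x : 0 <= tail_prob xi x := tail_ge0 xi x.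
Let G_le1 x : tail_prob xi x <= 1 := tail_le1 xi x.

Lemma cvg_block_mean u : 0 <= u -> mean n u / L n @[n --> \oo] --> c.
Proof.
move=> u0; apply: (cvg_block_sum G_ge0 G_le1 c_gt0 G_lim delta_gt0) => n.
exact: frac01.
Qed.

Lemma near_block_scale (A : R) : \forall n \near \oo,
  [/\ 1 <= delta * n%:R, 0 < L n & A <= q n].
Proof.
near=> n.
have L1 : A ^+ 2 + 1 <= L n by near: n; exact: near_ln_ge.
have L0 : 0 < L n by have := sqr_ge0 A; lra.
split => //.
  rewrite mulrC -ler_pdivrMr//; near: n; exact: nbhs_infty_ger.
rewrite (le_trans (ler_norm _))// -sqrtr_sqr ler_sqrt ?(ltW L0)//; lra.
Unshelve. all: by end_near. Qed.

(** The exponent is half the sum of the b(u)^2 E B_u / log n, and the error terms are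
    of order (log n)^(-1/2) and 1 / log n since the squares of the tail are summable. *)
Theorem block_cos_cvg (U : seq R) (b : R -> R) (th : R) :
    uniq U -> separated delta U ->
  \int[P]_w cos (\sum_(u <- U) b u * block_var xi delta n u w + th) @[n --> \oo] -->
  expR (- (\sum_(u <- U) b u ^+ 2 * c / 2)) * cos th.
Proof.
move=> uU sU; have [U0 _] := sU.
have [C HC] := block_sum_sqr_bound G_ge0 G_le1 c_gt0 G_lim.
pose err (n : nat) : R := \sum_(u <- U)
  (2 * `|b u| ^+ 3 * (mean n u / L n * (q n)^-1) + b u ^+ 2 * C * (L n)^-1).
have err0 : err n @[n --> \oo] --> 0.
  have -> : 0 = \sum_(u <- U) (2 * `|b u| ^+ 3 * (c * 0) + b u ^+ 2 * C * 0) :> R.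
    by rewrite big1// => u _; rewrite !mulr0 addr0.
  apply: cvg_sum_seq => u uU'; apply: cvgD; apply: cvgM; try exact: cvg_cst.
    by apply: cvgM; [apply: cvg_block_mean; exact: U0|exact: cvg_inv_sqrt_ln].
  exact: cvg_inv_ln.
(* expo n is half of the sum of b'^2 p over all the events of the blocks. *)
pose expo (n : nat) : R := \sum_(u <- U) b u ^+ 2 / 2 * (mean n u / L n).
have expo_lim : expR (- expo n) * cos th @[n --> \oo] -->
    expR (- (\sum_(u <- U) b u ^+ 2 * c / 2)) * cos th.
  apply: cvgM; last exact: cvg_cst.
  apply: (cvg_comp (fun n => - expo n) expR); last exact: continuous_expR.
  apply: cvgN.
  have -> : \sum_(u <- U) b u ^+ 2 * c / 2 = \sum_(u <- U) b u ^+ 2 / 2 * c.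
    by apply: eq_bigr => u _; rewrite mulrAC.
  apply: cvg_sum_seq => u uU'; apply: cvgM; first exact: cvg_cst.
  by apply: cvg_block_mean; exact: U0.
have close : \forall n \near \oo,
   `|\int[P]_w cos (\sum_(u <- U) b u * block_var xi delta n u w + th) -
     expR (- expo n) * cos th| <= err n.
  have := near_block_scale (\sum_(u <- U) `|b u| + 1); apply: filterS => n [dn L0 qn].
  have b0 : 0 <= \sum_(u <- U) `|b u| by rewrite sumr_ge0.
  have q0 : 0 < q n by lra.
  have q2 : q n ^+ 2 = L n by rewrite sqr_sqrtr// ltW.
  have mE (i : R * nat) : measurable (block_event xi n i) by exact: measurable_late.
  pose b' (i : R * nat) := b i.1 / q n.
  have b'1 i : i \in block_index delta U n -> `|b' i| <= 1.
    move=> /allpairsPdep[u [k [uU' _ ->]]].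
    rewrite /b' /= normrM normfV (gtr0_norm q0) ler_pdivrMr// mul1r (le_trans _ qn)//.
    by rewrite (bigD1_seq u)//= -addrA lerDl addr_ge0// sumr_ge0.
  have := centered_sum_cos mE th (independent_blocks xi_iid delta_gt0 sU dn)
    (block_index_uniq delta n uU) b'1.
  have -> : \int[P]_w cos (centered_sum P (block_event xi n) b' (block_index delta U n) w +
      th) =
      \int[P]_w cos (\sum_(u <- U) b u * block_var xi delta n u w + th).
    by apply: eq_Rintegral => w _; rewrite centered_sum_block.
  have -> : \sum_(i <- block_index delta U n) b' i ^+ 2 * fine (P (block_event xi n i)) / 2 =
      expo n.
    under eq_bigr do rewrite (probability_block_event xi_iid).
    rewrite (sum_block_index delta U n (fun u k => (b u / q n) ^+ 2 * tail_prob xi (k%:R +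
        frac n u) / 2)).
    apply: eq_bigr => u _; rewrite -mulr_suml -mulr_sumr -/(mean n u) expr_div_n q2.
    by field; rewrite gt_eqF.
  move=> H; apply: (le_trans H).
  under eq_bigr do rewrite (probability_block_event xi_iid).
  rewrite (sum_block_index delta U n (fun u k =>
    2 * `|b u / q n| ^+ 3 * tail_prob xi (k%:R + frac n u) +
    (b u / q n) ^+ 2 * tail_prob xi (k%:R + frac n u) ^+ 2)).
  rewrite /err big_seq [leRHS]big_seq; apply: ler_sum => u uU'.
  rewrite big_split/= -!mulr_sumr -/(mean n u); apply: lerD.
    rewrite normrM normfV (gtr0_norm q0) expr_div_n (exprS (q n)) q2.
    by rewrite le_eqVlt; apply/orP; left; apply/eqP; field; rewrite !gt_eqF.
  have hQ : \sum_(k < block delta n) tail_prob xi (k%:R + frac n u) ^+ 2 <= C.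
    by apply: HC; have /andP[] := frac01 n (U0 _ uU').
  rewrite expr_div_n q2 [leRHS]mulrAC ler_wpM2l// divr_ge0 ?sqr_ge0//; exact: ltW.
apply/cvgrPdist_le => e e0; have e20 : 0 < e / 2 by rewrite divr_gt0.
move/cvgrPdist_le : expo_lim => /(_ _ e20) H1.
move/cvgrPdist_le : err0 => /(_ _ e20) H2.
near=> n.
have h1 : `|expR (- (\sum_(u <- U) b u ^+ 2 * c / 2)) * cos th - expR (- expo n) * cos th| <=
    e / 2.
  by near: n.
have h2 : `|0 - err n| <= e / 2 by near: n.
have h3 : `|\int[P]_w cos (\sum_(u <- U) b u * block_var xi delta n u w + th) -
     expR (- expo n) * cos th| <= err n by near: n.
rewrite (le_trans (ler_distD (expR (- expo n) * cos th) _ _))//.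
rewrite [e]splitr lerD// distrC (le_trans h3)//.
by move: h2; rewrite sub0r normrN; apply: le_trans; exact: ler_norm.
Unshelve. all: by end_near. Qed.

(** A bound on the second moment, through |v| <= 1 + v^2. *)
Lemma block_var_moments (u : R) : 0 <= u -> \forall n \near \oo,
  P.-integrable setT (EFin \o block_var xi delta n u) /\
  \int[P]_w `|block_var xi delta n u w| <= c + 2.
Proof.
move=> u0.
have sU : separated delta [:: u].
  split=> [v|v v']; rewrite !inE; first by move=> /eqP ->.
  by move=> /eqP -> /eqP ->; rewrite ltxx.
have /cvgrPdist_le/(_ _ ltr01) Hc := cvg_block_mean u0.
near=> n.
have [dn L0 q1] : [/\ 1 <= delta * n%:R, 0 < L n & 1 <= q n].
  by near: n; exact: near_block_scale.
have h : `|c - mean n u / L n| <= 1 by near: n.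
have q0 : 0 < q n by lra.
have q2 : q n ^+ 2 = L n by rewrite sqr_sqrtr// ltW.
have mE (i : R * nat) : measurable (block_event xi n i) by exact: measurable_late.
have [i2 e2] := centered_sum_sqr (fun i => 1 / q n) mE (independent_blocks xi_iid delta_gt0 sU
    dn)
    (block_index_uniq delta n (isT : uniq [:: u])).
have VE w : centered_sum P (block_event xi n) (fun=> 1 / q n) (block_index delta [:: u] n) w =
    block_var xi delta n u w.
  by rewrite (centered_sum_block xi_iid delta [:: u] (fun=> 1)) big_seq1 mul1r.
have mV : measurable_fun setT (block_var xi delta n u).
  apply: measurable_funM => //; apply: measurable_funB => //.
  by apply: measurable_sum => k; apply: measurable_indic; exact: measurable_late.
have iV2 : P.-integrable setT (EFin \o (fun w => block_var xi delta n u w ^+ 2)).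
  by move: i2; congr (integrable _ _ _); apply/funext => w /=; rewrite VE.
have eV2 : \int[P]_w (block_var xi delta n u w ^+ 2) <= c + 1.
  have -> : \int[P]_w (block_var xi delta n u w ^+ 2) = \int[P]_w
      (centered_sum P (block_event xi n) (fun=> 1 / q n) (block_index delta [:: u] n) w ^+ 2).
    by apply: eq_Rintegral => w _; rewrite VE.
  apply: (le_trans e2); under eq_bigr do rewrite (probability_block_event xi_iid).
  rewrite (sum_block_index delta [:: u] n (fun u k => (1 / q n) ^+ 2 * tail_prob xi (k%:R +
      frac n u))).
  rewrite big_seq1 -mulr_sumr -/(mean n u) expr_div_n q2 expr1n mul1r mulrC.
  by move: h; rewrite ler_norml => /andP[]; lra.
have i12 : P.-integrable setT (EFin \o (fun w => 1 + block_var xi delta n u w ^+ 2)).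
  by apply: integrable_addr => //; exact: integrable_cst.
have dom w : `|block_var xi delta n u w| <= 1 + block_var xi delta n u w ^+ 2.
  rewrite -(real_normK (num_real (block_var _ _ _ _ _))).
  by have := sqr_ge0 (`|block_var xi delta n u w| - 2^-1); set a := `|_|; nra.
have iV : P.-integrable setT (EFin \o block_var xi delta n u).
  apply: le_integrable i12 => //; first exact/measurable_EFinP.
  by move=> w _; rewrite /= lee_fin (le_trans (dom w))// ler_norm.
split => //.
apply: (@le_trans _ _ (\int[P]_w (1 + block_var xi delta n u w ^+ 2))).
  by apply: le_Rintegral => //; exact: integrable_norm.
rewrite RintegralD//; last exact: integrable_cst.
rewrite Rintegral_prob_cst; lra.
Unshelve. all: by end_near. Qed.

End block_limits.

Section traffic_blocks.
Context (d : measure_display) (T : measurableType d) (R : realType).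
Context (P : probability T R) (xi : int -> {RV P >-> R}) (c : R).
Hypothesis xi_iid : iid xi.
Hypothesis xi_gt0 : forall j : int, {ae P, forall w, 0 < xi j w}.
Hypothesis c_gt0 : 0 < c.
Hypothesis xi_tail : fine (P [set w | x < xi 0 w]) / (c / x) @[x --> +oo] --> (1 : R).
Variable delta : R.
Hypothesis delta_gt0 : 0 < delta.

Local Notation q n := (Num.sqrt (ln (n%:R : R))).

Definition remainder (n : nat) (t : R) (w : T) : R :=
  centered_traffic xi n t w - (block_var xi delta n 0 w - block_var xi delta n t w).

Lemma centered_traffic0 n w : centered_traffic xi n 0 w = 0.
Proof.
rewrite /centered_traffic mulr0 floor0 subr0.
suff -> : traffic_count xi 0 w = 0%E by rewrite mul0r.
rewrite /traffic_count esum1// => j _.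
by rewrite set_itvoc0 indic0.
Qed.

(** At t = 0 both sides vanish identically; this case is kept so that no time has to
    be singled out later. *)
Lemma remainder_bound (t : R) : 0 <= t -> (0 < t -> 2 * delta <= t) ->
  exists C : R, \forall n \near \oo,
    P.-integrable setT (EFin \o remainder n t) /\ \int[P]_w `|remainder n t w| <= C / q n.
Proof.
rewrite le_eqVlt => /predU1P[<- _|t0 /(_ t0) dt].
  exists 0; apply: nearW => n.
  have r0 : remainder n 0 = fun=> 0.
    by apply/funext => w; rewrite /remainder centered_traffic0 subrr subr0.
  rewrite r0; split; first exact: integrable_cst.
  by under eq_Rintegral do rewrite normr0; rewrite Rintegral_prob_cst mul0r.
have [C HC] := block_remainder_bound (tail_ge0 xi) (tail_le1 xi) c_gt0 xi_tail delta_gt0 t0.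
exists (C + 1); near=> n.
have [dn L0 q1] : [/\ 1 <= delta * n%:R, 0 < ln (n%:R : R) & 1 <= q n].
  by near: n; exact: near_block_scale.
have q0 : 0 < q n by lra.
have nt0 : 0 <= n%:R * t by rewrite mulr_ge0// ltW.
have Kt : (block delta n <= Num.trunc (n%:R * t))%N.
  apply: le_truncn; rewrite mulrC ler_wpM2l//; have := delta_gt0; lra.
have HCn : ((Num.trunc (n%:R * t)).*2.+1)%:R * tail_prob xi (block delta n)%:R +
    (block delta n)%:R * tail_prob xi (n%:R * t) <= C.
  by move: Kt; near: n.
pose D w := fine (traffic_count xi (n%:R * t) w) - (Num.trunc (n%:R * t))%:R
  - (late_count xi 0 0 (block delta n) w - late_count xi (n%:R * t) (Num.trunc (n%:R * t))
      (block delta n) w).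
have itv := truncn_itv nt0.
have floorE : Num.floor (n%:R * t) = (Num.trunc (n%:R * t))%:Z.
  have addS (k : nat) : k%:Z + 1 = k.+1%:Z by rewrite addrC -intS.
  by apply: floor_def; rewrite addS.
have mlate s n0 K : measurable_fun setT (late_count xi s n0 K).
  by apply: measurable_sum => k; apply: measurable_indic; exact: measurable_late.
have trafficE w : fine (traffic_count xi (n%:R * t) w) =
    q n * centered_traffic xi n t w + (Num.trunc (n%:R * t))%:R.
  by rewrite /centered_traffic floorE -pmulrn; field; rewrite gt_eqF.
have mD : measurable_fun setT D.
  apply: measurable_funB; last exact: measurable_funB.
  apply: measurable_funB => //.
  rewrite (_ : (fun w => _) = (fun w => q n * centered_traffic xi n t w + (Num.trunc (n%:R *
      t))%:R)); last exact/funext.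
  by apply: measurable_funD => //; apply: measurable_funM.
have [iD eD] := traffic_remainder xi_iid xi_gt0 itv Kt mD.
pose shift := block_mean xi delta n t - block_mean xi delta n 0.
have remE w : remainder n t w = (q n)^-1 * (D w - shift).
  rewrite /remainder /block_var /D /shift trafficE mulr0 truncn0; field.
  by rewrite gt_eqF.
have shift1 : `|shift| <= 1.
  have := block_sum_shift (tail_ge0 xi) (tail_le1 xi) (tail_nonincreasing xi) (block delta n)
      (frac01 n (ltW t0)).
  by rewrite /shift distrC /block_mean /frac mulr0 truncn0 subr0.
have iDs : P.-integrable setT (EFin \o (fun w => D w - shift)).
  by apply: integrable_subr => //; exact: integrable_cst.
have ir : P.-integrable setT (EFin \o remainder n t).
  by rewrite (_ : remainder n t = fun w => (q n)^-1 * (D w - shift)); [exact: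
      integrable_mulrl|exact/funext].
split => //.
have iaD : P.-integrable setT (EFin \o (fun w => `|D w|)) by exact: integrable_norm.
apply: (@le_trans _ _ (\int[P]_w ((q n)^-1 * (`|D w| + 1)))).
  apply: le_Rintegral => //.
  - exact: integrable_norm.
  - by apply: integrable_mulrl; apply: integrable_addr => //; exact: integrable_cst.
  - move=> w _; rewrite remE normrM normfV (gtr0_norm q0) ler_wpM2l ?invr_ge0 ?(ltW q0)//.
    by rewrite (le_trans (ler_normB _ _))// lerD2l.
rewrite RintegralZl//; last by apply: integrable_addr => //; exact: integrable_cst.
rewrite RintegralD//; last exact: integrable_cst.
rewrite Rintegral_prob_cst mulrC ler_wpM2r ?invr_ge0 ?(ltW q0)// lerD2r.
exact: le_trans eD HCn.
Unshelve. all: by end_near. Qed.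

End traffic_blocks.

(** * The limit process *)

Section time_points.
Context {R : realType}.

Lemma exists_separated (U : seq R) : (forall u, u \in U -> 0 <= u) ->
  exists2 delta : R, 0 < delta & separated delta U.
Proof.
move=> U0.
have min_pos (s : seq R) : exists2 e : R, 0 < e & forall x, x \in s -> 0 < x -> e <= x.
  elim: s => [|y s [e e0 es]]; first by exists 1.
  have [y0|y0] := ltP 0 y; last first.
    exists e => // x; rewrite inE => /predU1P[->|/es//].
    by rewrite ltNge y0.
  exists (Num.min e y); first by rewrite lt_min e0.
  move=> x; rewrite inE => /predU1P[->|xs x0]; first by rewrite ge_min lexx orbT.
  by rewrite ge_min es.
have [e e0 es] := min_pos [seq v - u | v <- U, u <- U].
exists (e / 2); first by rewrite divr_gt0.
split => // u v uU vU uv.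
have vuU : v - u \in [seq v - u | v <- U, u <- U].
  by apply/allpairsP; exists (v, u).
by have := es _ vuU; rewrite subr_gt0 => /(_ uv); lra.
Qed.

Context {m : nat} (U : seq R) (t : 'I_m -> R) (a : 'I_m -> R).
Hypothesis uU : uniq U.
Hypothesis U0 : 0 \in U.
Hypothesis tU : forall i, t i \in U.

(** The weight of V(u) in the sum of the a_i (V(0) - V(t_i)), where times may repeat
    and may be 0. *)
Definition increment_coef (u : R) : R :=
  \sum_i a i * ((u == 0)%:R - (u == t i)%:R).

Lemma sum_increment_coef (F : R -> R) :
  \sum_(u <- U) increment_coef u * F u = \sum_i a i * (F 0 - F (t i)).
Proof.
have pick u0 : u0 \in U -> \sum_(u <- U) (u == u0)%:R * F u = F u0.
  move=> u0U; rewrite (bigD1_seq u0)//= eqxx mul1r big1 ?addr0// => u /negbTE ->.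
  by rewrite mul0r.
under eq_bigr do rewrite mulr_suml.
rewrite exchange_big/=; apply: eq_bigr => i _.
under eq_bigr do rewrite -mulrA mulrBl.
by rewrite -mulr_sumr sumrB !pick.
Qed.

(** The kernel on the right is the covariance of Z: 0 if a time vanishes, 2 on the
    diagonal and 1 otherwise. *)
Lemma sum_increment_coef_sqr :
  \sum_(u <- U) increment_coef u ^+ 2 = \sum_i \sum_j a i * a j *
    (1 - (t i == 0)%:R - (t j == 0)%:R + (t i == t j)%:R).
Proof.
under eq_bigr do rewrite expr2.
rewrite sum_increment_coef; apply: eq_bigr => i _.
rewrite /increment_coef -sumrB mulr_sumr; apply: eq_bigr => j _.
by rewrite eqxx (eq_sym 0 (t j)) /= mulr1n; ring.
Qed.

End time_points.

Section gaussian_side.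
Context (R : realType) (d' : measure_display) (T' : measurableType d').
Context (P' : probability T' R) (Z : {nonneg R} -> {RV P' >-> R}).
Hypothesis Z_gaussian : gaussian_process Z.
Hypothesis Z_mean : forall t : {nonneg R}, ('E_P'[Z t] = 0)%E.
Hypothesis Z_0 : {ae P', forall w, Z 0%:nng w = 0}.
Hypothesis Z_var : forall t : {nonneg R}, 0 < t%:num -> ('V_P'[Z t] = 2%:E)%E.
Hypothesis Z_cov : forall s t : {nonneg R}, 0 < s%:num -> 0 < t%:num ->
  s%:num != t%:num -> covariance P' (Z s) (Z t) = 1%E.

Lemma covariance_centered s t : covariance P' (Z s) (Z t) = (\int[P']_w (Z s w * Z t w)%:E)%E.
Proof.
rewrite covariance.unlock !Z_mean /= unlock.
by apply: eq_integral => w _; rewrite -[LHS]/((Z s w - 0) * (Z t w - 0))%:E !subr0.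
Qed.

Lemma measurable_ZZ s t : measurable_fun setT (fun w => Z s w * Z t w).
Proof. exact: measurable_funM. Qed.

Lemma nonneg_case (t : {nonneg R}) : t = 0%:nng \/ 0 < t%:num.
Proof.
have : 0 <= t%:num by []. rewrite le_eqVlt => /orP[/eqP t0|]; last by right.
by left; apply: val_inj.
Qed.

(** As Z t is centred, its variance is the integral of its square. *)
Lemma integrable_Z_sqr t : P'.-integrable setT (EFin \o (fun w => Z t w * Z t w)).
Proof.
apply/integrableP; split; first exact/measurable_EFinP/measurable_ZZ.
have -> : (\int[P']_x `|(EFin \o (fun w => (Z t w * Z t w)%R)) x| =
    \int[P']_x (Z t x * Z t x)%:E)%E.
  by apply: eq_integral => w _ /=; rewrite ger0_norm// -expr2 sqr_ge0.
have [->|t0] := nonneg_case t; last by rewrite -covariance_centered [X in (X < _)%E]Z_var//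
    ltry.
rewrite (@ae_eq_integral _ _ _ P' setT (cst 0%E))//.
- by rewrite integral0 ltry.
- exact/measurable_EFinP/measurable_ZZ.
- by move: Z_0; apply: filterS => w /= -> _; rewrite mul0r.
Qed.

Lemma integrable_ZZ s t : P'.-integrable setT (EFin \o (fun w => Z s w * Z t w)).
Proof.
apply: (@le_integrable _ _ _ P' setT measurableT _
   (EFin \o (fun w => Z s w * Z s w + Z t w * Z t w))).
- exact/measurable_EFinP/measurable_ZZ.
- move=> w _ /=; rewrite lee_fin normrM [leRHS]ger0_norm; last first.
    by rewrite addr_ge0// -expr2 sqr_ge0.
  rewrite -!expr2 -(real_normK (num_real (Z s w))) -(real_normK (num_real (Z t w))).
  have := sqr_ge0 (`|Z s w| - `|Z t w|); have := normr_ge0 (Z s w); have := normr_ge0 (Z t w).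
  by set x := `|Z s w|; set y := `|Z t w|; nra.
- by apply: integrable_addr; exact: integrable_Z_sqr.
Qed.

Lemma integrable_Z t : P'.-integrable setT (EFin \o Z t).
Proof.
apply: (@le_integrable _ _ _ P' setT measurableT _
   (EFin \o (fun w => 1 + Z t w * Z t w))).
- exact/measurable_EFinP.
- move=> w _ /=; rewrite lee_fin [leRHS]ger0_norm; last first.
    by rewrite addr_ge0// -expr2 sqr_ge0.
  rewrite -expr2 -(real_normK (num_real (Z t w))).
  by have := sqr_ge0 (`|Z t w| - 2^-1); set y := `|Z t w|; nra.
- by apply: integrable_addr; [exact: integrable_cst|exact: integrable_Z_sqr].
Qed.

Lemma Rintegral_Z t : \int[P']_w Z t w = 0.
Proof.
apply: EFin_inj; rewrite -(integrable_expectationE (integrable_Z t)).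
exact: Z_mean.
Qed.

Lemma Rintegral_ZZ s t : \int[P']_w (Z s w * Z t w) =
  1 - (s%:num == 0)%:R - (t%:num == 0)%:R + (s%:num == t%:num)%:R.
Proof.
have Z00 u : \int[P']_w (Z 0%:nng w * Z u w) = 0.
  rewrite /Rintegral (@ae_eq_integral _ _ _ P' setT (cst 0%E))//.
  - by rewrite integral0.
  - exact/measurable_EFinP/measurable_ZZ.
  - by move: Z_0; apply: filterS => w /= -> _; rewrite mul0r.
have z0 : (0%:nng : {nonneg R})%:num == 0 by [].
have [->|s0] := nonneg_case s; have [->|t0] := nonneg_case t.
- by rewrite Z00 z0 ?eqxx /= mulr1n; ring.
- have t0' : (t%:num == 0) = false by rewrite gt_eqF.
  have t0'' : ((0%:nng : {nonneg R})%:num == t%:num) = false by rewrite lt_eqF.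
  by rewrite Z00 z0 t0' t0'' /= mulr1n mulr0n; ring.
- under eq_Rintegral do rewrite mulrC.
  have s0' : (s%:num == 0) = false by rewrite gt_eqF.
  have s0'' : (s%:num == (0%:nng : {nonneg R})%:num) = false by rewrite gt_eqF.
  by rewrite Z00 z0 s0' ?s0'' /= mulr1n mulr0n; ring.
have s0' : (s%:num == 0) = false by rewrite gt_eqF.
have t0' : (t%:num == 0) = false by rewrite gt_eqF.
rewrite /Rintegral -covariance_centered s0' t0'.
have [/val_inj<-|st] := eqVneq s%:num t%:num.
  by rewrite [covariance _ _ _]Z_var//= mulr0n mulr1n; ring.
by rewrite Z_cov//= !mulr0n; ring.
Qed.

Lemma gaussian_process_cos (c : R) (m : nat) (t : 'I_m -> {nonneg R}) (a : 'I_m -> R) (th : R) :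
  0 <= c ->
  \int[P']_w cos (\sum_i a i * (Num.sqrt c \o* Z (t i))%R w + th) =
  expR (- (c * (\sum_i \sum_j a i * a j *
    (1 - ((t i)%:num == 0)%:R - ((t j)%:num == 0)%:R + ((t i)%:num == (t j)%:num)%:R)) / 2)) *
        cos th.
Proof.
move=> c0; pose W w := \sum_i (a i * Num.sqrt c) * Z (t i) w.
have mW : measurable_fun setT W by apply: measurable_sum => i; exact: measurable_funM.
pose W' : {RV P' >-> R} := HB.pack W (isMeasurableFun.Build _ _ _ _ _ mW).
have [mu [s [_ law]]] := Z_gaussian (fun i => a i * Num.sqrt c) t.
have WE w : \sum_i a i * (Num.sqrt c \o* Z (t i))%R w = W' w.
  by apply: eq_bigr => i _ /=; rewrite mulrA mulrAC.
under eq_Rintegral do rewrite WE.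
apply: (@gaussian_law_cos _ _ _ P' W' mu s) => //.
  rewrite /W' /= Rintegral_sumr; last by move=> i; exact/integrable_mulrl/integrable_Z.
  rewrite big1// => i _; rewrite RintegralZl//; last exact: integrable_Z.
  by rewrite Rintegral_Z mulr0.
transitivity (\int[P']_w (\sum_i \sum_j (a i * a j * c) * (Z (t i) w * Z (t j) w))).
  apply: eq_Rintegral => w _; rewrite expr2 /W' /= /W mulr_suml.
  apply: eq_bigr => i _; rewrite mulr_sumr; apply: eq_bigr => j _.
  rewrite -[in RHS](sqr_sqrtr c0); ring.
rewrite Rintegral_sumr; last first.
  move=> i; apply: integrable_sumr => j; exact/integrable_mulrl/integrable_ZZ.
rewrite mulr_sumr; apply: eq_bigr => i _.
rewrite Rintegral_sumr; last by move=> j; exact/integrable_mulrl/integrable_ZZ.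
rewrite mulr_sumr; apply: eq_bigr => j _.
rewrite RintegralZl//; last exact: integrable_ZZ.
by rewrite Rintegral_ZZ; ring.
Qed.

End gaussian_side.

(** * Finite-dimensional limits of the traffic *)

Section traffic_limit.
Context (d : measure_display) (T : measurableType d) (R : realType).
Context (P : probability T R) (xi : int -> {RV P >-> R}) (c : R).
Hypothesis xi_iid : iid xi.
Hypothesis xi_gt0 : forall j : int, {ae P, forall w, 0 < xi j w}.
Hypothesis c_gt0 : 0 < c.
Hypothesis xi_tail : fine (P [set w | x < xi 0 w]) / (c / x) @[x --> +oo] --> (1 : R).

Lemma centered_traffic_cos (m : nat) (t : 'I_m -> R) (a : 'I_m -> R) (th : R) :
    (forall i, 0 <= t i) ->
  \int[P]_w cos (\sum_i a i * centered_traffic xi n (t i) w + th) @[n --> \oo] -->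
  expR (- (c * (\sum_i \sum_j a i * a j *
    (1 - (t i == 0)%:R - (t j == 0)%:R + (t i == t j)%:R)) / 2)) * cos th.
Proof.
move=> t0.
pose U := undup (0 :: [seq t i | i <- enum 'I_m]).
have uU : uniq U by exact: undup_uniq.
have U0 : 0 \in U by rewrite mem_undup mem_head.
have tU i : t i \in U by rewrite mem_undup inE map_f ?orbT// mem_enum.
have Uge0 u : u \in U -> 0 <= u.
  by rewrite mem_undup inE => /predU1P[->//|/mapP[i _ ->]].
have [delta delta_gt0 sU] := exists_separated Uge0.
have sep i : 0 < t i -> 2 * delta <= t i.
  by move=> ti0; have [_ /(_ _ _ U0 (tU i) ti0)] := sU; rewrite add0r.
pose b := increment_coef t a.
have main := block_cos_cvg xi_iid c_gt0 xi_tail delta_gt0 (b := b) (th := th) uU sU.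
rewrite -(sum_increment_coef_sqr a uU U0 tU).
have -> : c * (\sum_(u <- U) increment_coef t a u ^+ 2) / 2 = \sum_(u <- U) b u ^+ 2 * c / 2.
  by rewrite mulrC mulrA mulr_sumr; apply: eq_bigr => u _; rewrite /b; ring.
have rem i := remainder_bound xi_iid xi_gt0 c_gt0 xi_tail delta_gt0 (t0 i) (sep i).
have /choice [C HC] := rem.
have Hrem : \forall n \near \oo, forall i,
    P.-integrable setT (EFin \o remainder xi delta n (t i)) /\
    \int[P]_w `|remainder xi delta n (t i) w| <= C i / Num.sqrt (ln (n%:R : R)).
  by apply: filter_forall => i; exact: HC.
pose D : R := \sum_i `|a i| * C i.
have Dlim : D * (Num.sqrt (ln (n%:R : R)))^-1 @[n --> \oo] --> (0 : R).
  by rewrite -(mulr0 D); apply: cvgM; [exact: cvg_cst|exact: cvg_inv_sqrt_ln].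
have mblock n u : measurable_fun setT (block_var xi delta n u).
  apply: measurable_funM => //; apply: measurable_funB => //.
  by apply: measurable_sum => k; apply: measurable_indic; exact: measurable_late.
have mcos (f : T -> R) : measurable_fun setT f -> measurable_fun setT (fun w => cos (f w)).
  move=> mf; apply: (@measurableT_comp _ _ _ _ _ _ (@cos R)) => //.
  by apply: continuous_measurable_fun; exact: continuous_cos.
have icos (f : T -> R) : measurable_fun setT f -> P.-integrable setT (EFin \o (fun w => cos (f
    w + th))).
  move=> mf; apply: (@bounded_integrable _ _ _ P _ 1).
    by apply: mcos; exact: measurable_funD.
  by move=> w; exact: cos_max.
have close : \forall n \near \oo,
   `|\int[P]_w cos (\sum_i a i * centered_traffic xi n (t i) w + th) -
     \int[P]_w cos (\sum_(u <- U) b u * block_var xi delta n u w + th)|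
     <= D * (Num.sqrt (ln (n%:R : R)))^-1.
  move: Hrem; apply: filterS => n Hn.
  pose X w := \sum_i a i * centered_traffic xi n (t i) w.
  pose V w := \sum_(u <- U) b u * block_var xi delta n u w.
  have mX : measurable_fun setT X by apply: measurable_sum => i; exact: measurable_funM.
  have mV : measurable_fun setT V by apply: measurable_sum => u; exact: measurable_funM.
  have iX := icos _ mX; have iV := icos _ mV.
  rewrite -/(X _) -/(V _) -RintegralB//.
  have iXV := integrable_subr iX iV.
  rewrite (le_trans (le_normr_Rintegral _ iXV))//.
  have irem i : P.-integrable setT (EFin \o (fun w => `|a i| * `|remainder xi delta n (t i)
      w|)).
    by apply: integrable_mulrl; apply: integrable_norm; exact: (Hn i).1.
  apply: (@le_trans _ _ (\int[P]_w (\sum_i `|a i| * `|remainder xi delta n (t i) w|))).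
    apply: le_Rintegral => //.
    - exact: integrable_norm.
    - exact: integrable_sumr.
    - move=> w _; rewrite (le_trans (cos_lipschitz _ _))//.
      have -> : X w + th - (V w + th) = \sum_i a i * remainder xi delta n (t i) w.
        rewrite /V (sum_increment_coef a uU U0 tU (fun u => block_var xi delta n u w)) /X.
        rewrite opprD addrACA subrr addr0 -sumrB; apply: eq_bigr => i _.
        by rewrite /remainder -mulrBr.
      rewrite (le_trans (ler_norm_sum _ _ _))//.
      by apply: ler_sum => i _; rewrite normrM.
  rewrite Rintegral_sumr// /D mulr_suml; apply: ler_sum => i _.
  rewrite RintegralZl//; last by apply: integrable_norm; exact: (Hn i).1.
  by rewrite -mulrA ler_wpM2l//; exact: (Hn i).2.
apply/cvgrPdist_le => e e0; have e20 : 0 < e / 2 by rewrite divr_gt0.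
move/cvgrPdist_le : main => /(_ _ e20) H1.
move/cvgrPdist_le : Dlim => /(_ _ e20) H2.
move: close H1 H2; apply: filterS3 => n h3 h1 h2.
rewrite (le_trans (ler_distD (\int[P]_w cos (\sum_(u <- U) b u * block_var xi delta n u w +
    th)) _ _))//.
rewrite [e]splitr lerD// distrC (le_trans h3)//.
by move: h2; rewrite sub0r normrN; apply: le_trans; exact: ler_norm.
Qed.

Lemma centered_traffic_moment (t : R) : 0 <= t -> \forall n \near \oo,
  P.-integrable setT (EFin \o centered_traffic xi n t) /\
  \int[P]_w `|centered_traffic xi n t w| <= 2 * c + 5.
Proof.
move=> t0.
pose delta : R := if t == 0 then 1 else t / 2.
have delta_gt0 : 0 < delta.
  rewrite /delta; case: ifPn => // tn0; rewrite divr_gt0// lt_neqAle eq_sym tn0//.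
have sep : 0 < t -> 2 * delta <= t.
  by move=> t1; rewrite /delta gt_eqF// mulrC divfK.
have [C HC] := remainder_bound xi_iid xi_gt0 c_gt0 xi_tail delta_gt0 t0 sep.
have H0 := block_var_moments xi_iid c_gt0 xi_tail delta_gt0 (lexx 0).
have Ht := block_var_moments xi_iid c_gt0 xi_tail delta_gt0 t0.
near=> n.
have [ir er] : P.-integrable setT (EFin \o remainder xi delta n t) /\
    \int[P]_w `|remainder xi delta n t w| <= C / Num.sqrt (ln (n%:R : R)) by near: n.
have [i0 e0] : P.-integrable setT (EFin \o block_var xi delta n 0) /\
    \int[P]_w `|block_var xi delta n 0 w| <= c + 2 by near: n.
have [it et] : P.-integrable setT (EFin \o block_var xi delta n t) /\
    \int[P]_w `|block_var xi delta n t w| <= c + 2 by near: n.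
have [_ L0 qC] : [/\ 1 <= delta * n%:R, 0 < ln (n%:R : R) & `|C| + 1 <= Num.sqrt (ln (n%:R :
    R))].
  by near: n; exact: near_block_scale.
have q0 : 0 < Num.sqrt (ln (n%:R : R)) by rewrite (lt_le_trans _ qC)// ltr_wpDl.
have Cq : C / Num.sqrt (ln (n%:R : R)) <= 1.
  by rewrite ler_pdivrMr// mul1r (le_trans (ler_norm _))// (le_trans _ qC)// lerDl.
have E w : centered_traffic xi n t w =
    (remainder xi delta n t w + block_var xi delta n 0 w) - block_var xi delta n t w.
  by rewrite /remainder; ring.
have iX : P.-integrable setT (EFin \o centered_traffic xi n t).
  rewrite (_ : (centered_traffic xi n t : T -> R) = fun w => (remainder xi delta n t w +
      block_var xi delta n 0 w) - block_var xi delta n t w); last exact/funext.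
  by apply: integrable_subr => //; exact: integrable_addr.
split => //.
have ia1 : P.-integrable setT (EFin \o (fun w => `|remainder xi delta n t w|)) by exact:
    integrable_norm.
have ia2 : P.-integrable setT (EFin \o (fun w => `|block_var xi delta n 0 w|)) by exact:
    integrable_norm.
have ia3 : P.-integrable setT (EFin \o (fun w => `|block_var xi delta n t w|)) by exact:
    integrable_norm.
have ia12 := integrable_addr ia1 ia2.
apply: (@le_trans _ _ (\int[P]_w ((`|remainder xi delta n t w| + `|block_var xi delta n 0 w|) +
    `|block_var xi delta n t w|))).
  apply: le_Rintegral => //.
  - exact: integrable_norm.
  - exact: integrable_addr.
  - move=> w _; rewrite E (le_trans (ler_normB _ _))// lerD2r.
    exact: ler_normD.
rewrite RintegralD// RintegralD//; lra.
Unshelve. all: by end_near. Qed.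

End traffic_limit.

Theorem theorem2 (R : realType)
    (disp : measure_display) (T : measurableType disp) (P : probability T R)
    (xi : int -> {RV P >-> R}) (c : R)
    (disp' : measure_display) (T' : measurableType disp')
    (P' : probability T' R) (Z : {nonneg R} -> {RV P' >-> R})
    (xi_iid : iid xi)
    (xi_gt0 : forall j : int, {ae P, forall w, 0 < xi j w})
    (c_gt0 : 0 < c)
    (xi_tail : fine (P [set w | x < xi 0 w]) / (c / x) @[x --> +oo] --> (1 : R))
    (Z_gaussian : gaussian_process Z)
    (Z_mean : forall t : {nonneg R}, ('E_P'[Z t] = 0)%E)
    (Z_0 : {ae P', forall w, Z 0%:nng w = 0})
    (Z_var : forall t : {nonneg R}, 0 < t%:num -> ('V_P'[Z t] = 2%:E)%E)
    (Z_cov : forall s t : {nonneg R}, 0 < s%:num -> 0 < t%:num ->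
      s%:num != t%:num -> covariance P' (Z s) (Z t) = 1%E)
    (m : nat) (m_ge1 : (1 <= m)%N) (t : 'I_m -> {nonneg R}) :
  cvg_in_distribution P P' (fun n i => centered_traffic xi n (t i)%:num)
    (fun i => Num.sqrt c \o* Z (t i)).
Proof.
have iY i : P'.-integrable setT (EFin \o (Num.sqrt c \o* Z (t i))%R).
  have := integrable_mulrl (Num.sqrt c) (integrable_Z Z_mean Z_0 Z_var (t i)).
  by congr (integrable _ _ _); apply/funext => w /=; rewrite mulrC.
pose S : R := \sum_i \int[P']_w `|(Num.sqrt c \o* Z (t i))%R w|.
have S0 i : 0 <= \int[P']_w `|(Num.sqrt c \o* Z (t i))%R w| by exact: Rintegral_ge0.
apply: (@cvg_in_distribution_cos _ _ _ _ _ _ _ _ _ _ (2 * c + 5 + S)).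
- move=> a th.
  rewrite (gaussian_process_cos Z_gaussian Z_mean Z_0 Z_var Z_cov t a th (ltW c_gt0)).
  by apply: (centered_traffic_cos xi_iid xi_gt0 c_gt0 xi_tail (t := fun i => (t i)%:num)).
- apply: filter_forall => i.
  have ti0 : 0 <= (t i)%:num by [].
  have := centered_traffic_moment xi_iid xi_gt0 c_gt0 xi_tail ti0.
  apply: filterS => n [iX eX]; split => //.
  by rewrite (le_trans eX)// lerDl sumr_ge0.
- move=> i; split; first exact: iY.
  rewrite (@le_trans _ _ S)//; last by rewrite lerDr addr_ge0// mulr_ge0// ltW.
  by rewrite /S (bigD1 i)//= lerDl; apply: sumr_ge0 => j _; exact: S0.
Qed.
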